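(* Assume $p>0$. Then $$\int_0^u \cos (px)\,\cosh\!\left(q\sqrt{u^2-x^2}\right)\frac{dx}{(u^2-x^2)^{\nu+1/2}}=\pi\sum_{n=0}^\infty \frac{q^{2n}}{2^{n+\nu+1}}\,\frac{u^{n-\nu}}{p^{n-\nu}}\,\frac{\Gamma(n+\frac12-\nu)}{\Gamma(n+\frac12)}\,\frac{J_{n-\nu}(pu)}{n!}.$$
   Context: $J_\mu$ denotes the Bessel function of the first kind of order $\mu$, and $\Gamma$ the Gamma function. *)

(* Defs.v *)
From Stdlib Require Import Reals ZArith.
From Coquelicot Require Import Coquelicot.

Open Scope R_scope.
Open Scope C_scope.

Definition Cexp (z : C) : C :=
  RtoC (exp (Re z)) * (cos (Im z), sin (Im z)).

Definition Ccosh (z : C) : C := (Cexp z + Cexp (- z)) / RtoC 2.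

(* Principal power [a^z = exp (z ln a)]; only meaningful for [0 < a], because
   [ln] is [0] on nonpositive reals. *)
Definition Rcpow (a : R) (z : C) : C := Cexp (z * RtoC (ln a)).

(* Sum of a complex series, taken componentwise; meaningful when it converges. *)
Definition CSeries (a : nat -> C) : C :=
  (Series (fun n => Re (a n)), Series (fun n => Im (a n))).

(* Euler's integral, convergent for [0 < Re z]. *)
Definition Gamma_int (z : C) : C :=
  RInt_gen (V := C_R_CompleteNormedModule)
    (fun t : R => Rcpow t (z - RtoC 1) * RtoC (exp (- t)))
    (at_right 0) (Rbar_locally p_infty).

(* [Gamma_shift m z] is [Gamma_int (z + m) / (z (z + 1) ... (z + m - 1))]. *)
Fixpoint Gamma_shift (m : nat) (z : C) : C :=
  match m with
  | O => Gamma_int z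
  | S m' => Gamma_shift m' (z + RtoC 1) / z
  end.

(* The Gamma function, continued to [C] by [Gamma (z + 1) = z Gamma z].  The
   number of shifts is the least [m] with [0 < Re z + m]; it is [0] exactly when
   [0 < Re z].  At the poles [0, -1, -2, ...] the value is [0], since division
   by [0] gives [0]; hence [/ Gamma z] is the entire function 1/Gamma for all
   [z], as needed in the Bessel series at negative integer orders. *)
Definition Gamma (z : C) : C :=
  Gamma_shift (Z.to_nat (up (- Re z)%R)) z.

(* Bessel function of the first kind of complex order [mu], at [0 < x]:
   sum over k of (-1)^k / (k! Gamma (k + mu + 1)) (x/2)^(2k + mu). *)
Definition BesselJ (mu : C) (x : R) : C :=
  CSeries (fun k : nat =>
    RtoC ((-1) ^ k) / (RtoC (INR (fact k)) * Gamma (RtoC (INR k) + mu + RtoC 1))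
    * Rcpow (x / 2) (RtoC (2 * INR k) + mu)).

Definition lhs_integrand (u p : R) (q nu : C) (x : R) : C :=
  RtoC (cos (p * x)) * Ccosh (q * RtoC (sqrt (u ^ 2 - x ^ 2)))
  / Rcpow (u ^ 2 - x ^ 2) (nu + RtoC (1 / 2)).

Definition rhs_term (u p : R) (q nu : C) (n : nat) : C :=
  q ^ (2 * n) / Rcpow 2 (RtoC (INR n) + nu + RtoC 1)
  * (Rcpow u (RtoC (INR n) - nu) / Rcpow p (RtoC (INR n) - nu))
  * (Gamma (RtoC (INR n) + RtoC (1 / 2) - nu) / Gamma (RtoC (INR n) + RtoC (1 / 2)))
  * (BesselJ (RtoC (INR n) - nu) (p * u) / RtoC (INR (fact n))).

(* Main.v *)
(** Expanding [cosh (q sqrt (u^2 - x^2))] in powers of [q] reduces the claim to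
    Poisson's integral, the integral of [cos (p x) (u^2 - x^2)^(s - 1)] over
    [0 <= x < u] with [s = n - nu + 1/2]; expanding the cosine reduces that in turn
    to the Beta integrals [I_k(s)] of [x^(2k) (1 - x^2)^(s - 1)].  Both
    interchanges hold because the partial sums of cosh converge uniformly on
    bounded sets and the weight is absolutely integrable.

    The relation between [I_0] and Gamma is obtained without Fubini:
    [F(s) = I_0(s) Gamma(s + 1/2) / Gamma(s)] has period 1, and
    [Gamma(s + n + 2) ~ n n! n^s] together with [I_0(s + n) ~ I_0(n)] gives
    [F(s) = lim sqrt n I_0(n + 2)], which does not depend on [s].  Comparing
    [F(1)] with [F(1/2)] yields [Gamma(1/2)^2 = PI].  Only Gamma arguments with
    positive real part occur. *)

Require Import Defs.
From Stdlib Require Import Reals ZArith Arith Lra Lia.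
From Coquelicot Require Import Coquelicot.

Open Scope R_scope.
Open Scope C_scope.

Local Notation CV := C_R_CompleteNormedModule (only parsing).

(** * Improper integrals over a convex domain *)

(** Integrals are limits along filters of possibly singular integrands. Existence always rests on a
    comparison test, and the dominating functions come down to derivatives of explicit functions.
    The cosine is treated as [Ccosh (Ci * x)], so one remainder estimate serves both expansions.
    What stands in for the usual double integral is concentration: against t^n e^(-t), the variable
    w = t / n has second moment about 1 of relative order 1/n, so w^s may be replaced by 1 at a
    relative cost of order 1 / sqrt n. Only integer moments, that is factorials, have to be
    computed. Shifting by n + 2 rather than n + 1 leaves one spare factor w, which pays for the
    factor 1/w in the bound on |w^s - 1|; the same device works for the weight w = 1 - x^2 of the
    Beta integrals. Poisson's integral is matched with the Bessel series term by term from a series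
    already known to converge, so convergence and value of each series come together. *)

Lemma norm_C (z : C) : norm (z : CV) = Cmod z.
Proof. symmetry; exact (Cmod_norm z). Qed.

(** [CV] is a module over the reals, so a complex constant is not a [scal]. It passes through
    integrals, series and derivatives as a bounded real-linear map instead, like [RtoC] and the two
    projections. *)
Lemma is_linear_Cmult (c : C) : is_linear (U := CV) (V := CV) (Cmult c).
Proof.
  split.
  - intros x y. exact (Cmult_plus_distr_l c x y).
  - intros k x. change (c * scal k x = scal k (c * x)). rewrite !scal_R_Cmult. ring.
  (* [is_linear] asks for a strictly positive bound, and [Cmod c] may vanish. *)
  - exists (Cmod c + 1)%R. split. { pose proof (Cmod_ge_0 c); lra. }
    intros x. rewrite !norm_C, Cmod_mult.
    pose proof (Cmod_ge_0 x). nra.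
Qed.

Lemma is_linear_RtoC : is_linear (U := R_NormedModule) (V := CV) RtoC.
Proof.
  split.
  - intros x y. exact (RtoC_plus x y).
  - intros k x. change (RtoC (k * x) = scal k (RtoC x)). now rewrite scal_R_Cmult, RtoC_mult.
  - exists 1%R. split; [lra|]. intros x. rewrite norm_C, Cmod_R. apply Req_le. symmetry. apply
      Rmult_1_l.
Qed.

Lemma Riemann_sum_linear {U V : NormedModule R_AbsRing} (T : U -> V) (f : R -> U) ptd :
  is_linear T -> Riemann_sum (fun x => T (f x)) ptd = T (Riemann_sum f ptd).
Proof.
  intros HT. induction ptd using SF_cons_ind.
  - unfold Riemann_sum; simpl. symmetry. apply (linear_zero T HT).
  - rewrite !Riemann_sum_cons, IHptd, (linear_plus T HT), (linear_scal T HT). reflexivity.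
Qed.

Lemma is_RInt_linear {U V : NormedModule R_AbsRing} (T : U -> V) (f : R -> U) a b l :
  is_linear T -> is_RInt f a b l -> is_RInt (fun x => T (f x)) a b (T l).
Proof.
  intros HT H. unfold is_RInt in *.
  eapply filterlim_ext; [|eapply filterlim_comp; [exact H | exact (linear_cont T l HT)]].
  intros ptd. simpl. rewrite (Riemann_sum_linear T f ptd HT). apply (linear_scal T HT).
Qed.

Lemma is_RInt_gen_linear {U V : NormedModule R_AbsRing} (T : U -> V) (f : R -> U) Fa Fb
  {FFa : Filter Fa} {FFb : Filter Fb} l :
  is_linear T -> is_RInt_gen f Fa Fb l -> is_RInt_gen (fun x => T (f x)) Fa Fb (T l).
Proof.
  intros HT H P HP.
  assert (H1 := H _ (linear_cont T l HT P HP)).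
  unfold filtermapi in *. eapply filter_imp; [|exact H1].
  intros ab [y [Hy Py]]. exists (T y). split; [|exact Py].
  now apply is_RInt_linear.
Qed.

Lemma minus_plus_middle {G : AbelianGroup} (x y z : G) : minus (plus (plus x y) z) y = plus x z.
Proof.
  unfold minus. rewrite <- !plus_assoc. apply (f_equal (plus x)).
  rewrite (plus_comm z), (plus_assoc y), (plus_opp_r y). apply plus_zero_l.
Qed.

Section ConvexDomain.
Context {V : CompleteNormedModule R_AbsRing} {Fa Fb : (R -> Prop) -> Prop}
  {FFa : ProperFilter Fa} {FFb : ProperFilter Fb}.
(** An interval that both endpoint filters eventually enter. Regularity and bounds are asked for on
    [D] only, because the integrands may be singular at an endpoint and take default values beyond
    it. The instances are [Dseg u] and [Dpos]. *)
Variable D : R -> Prop.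
Hypothesis Dconv : forall x y z, D x -> D y -> (x <= z <= y)%R -> D z.
Hypothesis Da : Fa D.
Hypothesis Db : Fb D.

Lemma D_Rmin x y z : D x -> D y -> (Rmin x y <= z <= Rmax x y)%R -> D z.
Proof.
  intros Hx Hy. unfold Rmin, Rmax. destruct (Rle_dec x y); intros; eauto.
Qed.

Lemma filter_prod_DD : filter_prod Fa Fb (fun ab => D (fst ab) /\ D (snd ab)).
Proof. exists D D; auto. Qed.

Lemma ex_RInt_D (f : R -> V) x y : (forall z, D z -> continuous f z) -> D x -> D y ->
  ex_RInt f x y.
Proof.
  intros Hf Hx Hy. apply (ex_RInt_continuous (V := V)). intros z Hz. apply Hf.
  exact (D_Rmin x y z Hx Hy Hz).
Qed.

(** The fundamental theorem with boundary values taken as limits. It yields the explicit integrals,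
    and also integration by parts: there both limits are 0 and [f] is a difference of two
    integrands. *)
Lemma is_RInt_gen_derive (F f : R -> V) la lb :
  (forall x, D x -> is_derive F x (f x)) -> (forall x, D x -> continuous f x) ->
  filterlim F Fa (locally la) -> filterlim F Fb (locally lb) ->
  is_RInt_gen f Fa Fb (minus lb la).
Proof.
  intros HF Hf Ha Hb P HP.
  assert (H1 : filterlim (fun ab => minus (F (snd ab)) (F (fst ab))) (filter_prod Fa Fb)
     (locally (minus lb la))).
  { unfold minus. eapply filterlim_comp_2.
    - eapply filterlim_comp; [apply filterlim_snd | exact Hb].
    - eapply filterlim_comp; [|apply (filterlim_opp la)].
      eapply filterlim_comp; [apply filterlim_fst | exact Ha].
    - apply (filterlim_plus lb (opp la)). }
  assert (H1' : filter_prod Fa Fb (fun ab => P (minus (F (snd ab)) (F (fst ab))))) by exact (H1 P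
      HP).
  unfold filtermapi. eapply filter_imp; [|exact (filter_and _ _ filter_prod_DD H1')].
  intros [a b] [[H2 H3] H4]. simpl in *.
  eexists. split; [|exact H4].
  apply (is_RInt_derive (V := V)).
  - intros x Hx. apply HF. now apply (D_Rmin a b).
  - intros x Hx. apply Hf. now apply (D_Rmin a b).
Qed.

(** The absolute value on the right allows [x] and [y] in either order, as needed for the end pieces
    in the Cauchy criterion. *)
Lemma norm_RInt_D (f : R -> V) (g : R -> R) x y :
  (forall z, D z -> continuous f z) -> (forall z, D z -> continuous g z) ->
  (forall z, D z -> norm (f z) <= g z)%R -> D x -> D y ->
  (norm (RInt f x y) <= Rabs (RInt g x y))%R.
Proof.
  intros Hf Hg Hfg Hx Hy.
  assert (E1 := RInt_correct _ _ _ (ex_RInt_D f x y Hf Hx Hy)).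
  assert (E2 : ex_RInt g x y).
  { apply (ex_RInt_continuous (V := R_CompleteNormedModule)). intros z Hz. apply Hg.
    exact (D_Rmin x y z Hx Hy Hz). }
  assert (E3 := RInt_correct _ _ _ E2).
  destruct (Rle_dec x y) as [Hxy|Hxy].
  - eapply Rle_trans; [|apply Rle_abs].
    apply (norm_RInt_le f g x y); auto. intros z Hz; apply Hfg. eauto.
  - rewrite <- (norm_opp (RInt f x y)), <- Rabs_Ropp.
    eapply Rle_trans; [|apply Rle_abs].
    apply (norm_RInt_le f g y x); [lra| |apply (is_RInt_swap f); exact E1 |].
    + intros z Hz; apply Hfg. eauto.
    + apply (is_RInt_swap g) . exact E3.
Qed.

(** With the far endpoint fixed at [b0] or [a0], two integrals that each lie within eps/2 of the
    limit differ by the integral over the piece between their near endpoints. *)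
Lemma RInt_gen_cauchy (g : R -> R) : (forall z, D z -> continuous g z) ->
  ex_RInt_gen g Fa Fb -> forall eps : posreal,
  exists P Q : R -> Prop, Fa P /\ Fb Q /\ (forall x, P x -> D x) /\ (forall x, Q x -> D x) /\
  (forall x y, P x -> P y -> Rabs (RInt g x y) < eps)%R /\
  (forall x y, Q x -> Q y -> Rabs (RInt g x y) < eps)%R.
Proof.
  intros Hg [l Hl] eps.
  assert (E : forall x y, D x -> D y -> ex_RInt g x y).
  { intros x y Hx Hy. apply (ex_RInt_continuous (V := R_CompleteNormedModule)). intros z Hz.
      apply Hg.
    exact (D_Rmin x y z Hx Hy Hz). }
  assert (Hb : locally l (fun y : R => Rabs (y - l) < eps / 2)%R).
  { exists (mkposreal _ (is_pos_div_2 eps)). intros y Hy. exact Hy. }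
  destruct (filter_and _ _ filter_prod_DD (Hl _ Hb)) as [P Q HP HQ HPQ].
  destruct (filter_ex P HP) as [a0 Pa0].
  destruct (filter_ex Q HQ) as [b0 Qb0].
  assert (K : forall x y, P x -> Q y -> (Rabs (RInt g x y - l) < eps / 2)%R).
  { intros x y Hx Hy. destruct (HPQ x y Hx Hy) as [_ [z [Hz1 Hz2]]]. simpl in Hz1.
    rewrite (is_RInt_unique (V := R_CompleteNormedModule) _ _ _ _ Hz1). exact Hz2. }
  assert (DP : forall x, P x -> D x) by (intros x Hx; apply (HPQ x b0 Hx Qb0)).
  assert (DQ : forall x, Q x -> D x) by (intros x Hx; apply (HPQ a0 x Pa0 Hx)).
  exists P, Q. repeat split; auto.
  - intros x y Hx Hy.
    assert (C1 := RInt_Chasles (V := R_CompleteNormedModule) g x y b0 (E _ _ (DP _ Hx) (DP _ Hy))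
        (E _ _ (DP _ Hy) (DQ _ Qb0))).
    change (RInt g x y + RInt g y b0 = RInt g x b0)%R in C1.
    assert (K1 := K x b0 Hx Qb0). assert (K2 := K y b0 Hy Qb0).
    apply Rabs_def2 in K1. apply Rabs_def2 in K2. apply Rabs_def1; lra.
  - intros x y Hx Hy.
    assert (C1 := RInt_Chasles (V := R_CompleteNormedModule) g a0 x y (E _ _ (DP _ Pa0) (DQ _
        Hx)) (E _ _ (DQ _ Hx) (DQ _ Hy))).
    change (RInt g a0 x + RInt g x y = RInt g a0 y)%R in C1.
    assert (K1 := K a0 x Pa0 Hx). assert (K2 := K a0 y Pa0 Hy).
    apply Rabs_def2 in K1. apply Rabs_def2 in K2. apply Rabs_def1; lra.
Qed.

(** Comparison test through the Cauchy criterion in a complete space: the integrals over [a, b] and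
    [a', b'] differ by two end pieces, and each is bounded by the corresponding piece of [g]. *)
Lemma ex_RInt_gen_dominated (f : R -> V) (g : R -> R) :
  (forall z, D z -> continuous f z) -> (forall z, D z -> continuous g z) ->
  (forall z, D z -> norm (f z) <= g z)%R ->
  ex_RInt_gen g Fa Fb -> ex_RInt_gen f Fa Fb.
Proof.
  intros Hf Hg Hfg Ig.
  unfold ex_RInt_gen, is_RInt_gen.
  apply (filterlimi_locally_cauchy (U := V)).
  - eapply filter_imp; [|apply filter_prod_DD]. intros [a b] [H1 H2]. simpl in *. split.
    + apply ex_RInt_D; auto.
    + intros y1 y2 Hy1 Hy2. apply is_RInt_unique in Hy1. apply is_RInt_unique in Hy2. congruence.
  - intros eps.
    destruct (RInt_gen_cauchy g Hg Ig (mkposreal _ (is_pos_div_2 eps))) as (P & Q & HP & HQ & DP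
        & DQ & KP & KQ).
    exists (fun ab => P (fst ab) /\ Q (snd ab)). split. { exists P Q; auto. }
    intros [a b] [a' b'] [Pa Qb] [Pa' Qb'] y y' Hy Hy'. simpl in *.
    apply is_RInt_unique in Hy. apply is_RInt_unique in Hy'. subst y y'.
    apply (norm_compat1 (V := V)).
    assert (C1 := RInt_Chasles f a' a b (ex_RInt_D _ _ _ Hf (DP _ Pa') (DP _ Pa)) (ex_RInt_D _ _
        _ Hf (DP _ Pa) (DQ _ Qb))).
    assert (C2 := RInt_Chasles f a' b b' (ex_RInt_D _ _ _ Hf (DP _ Pa') (DQ _ Qb)) (ex_RInt_D _ _
        _ Hf (DQ _ Qb) (DQ _ Qb'))).
    rewrite <- C2, <- C1.
    replace (minus _ (RInt f a b)) with (plus (RInt f a' a) (RInt f b b')).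
    2: symmetry; exact (minus_plus_middle (G := V) _ _ _).
    eapply Rle_lt_trans; [apply (norm_triangle (V := V))|].
    assert (N1 := norm_RInt_D f g _ _ Hf Hg Hfg (DP _ Pa') (DP _ Pa)).
    assert (N2 := norm_RInt_D f g _ _ Hf Hg Hfg (DQ _ Qb) (DQ _ Qb')).
    specialize (KP _ _ Pa' Pa). specialize (KQ _ _ Qb Qb'). simpl in *. lra.
Qed.

Hypothesis Dle : filter_prod Fa Fb (fun ab => fst ab <= snd ab)%R.

Lemma RInt_gen_norm_D (f : R -> V) (g : R -> R) lf lg :
  (forall z, D z -> norm (f z) <= g z)%R ->
  is_RInt_gen f Fa Fb lf -> is_RInt_gen g Fa Fb lg -> (norm lf <= lg)%R.
Proof.
  intros Hfg. apply RInt_gen_norm; auto.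
  eapply filter_imp; [|apply filter_prod_DD]. intros [a b] [H1 H2] x Hx. simpl in *.
  apply Hfg. eauto.
Qed.

Lemma is_RInt_gen_ext_D {W : NormedModule R_AbsRing} (f g : R -> W) l :
  (forall z, D z -> f z = g z) -> is_RInt_gen f Fa Fb l -> is_RInt_gen g Fa Fb l.
Proof.
  intros Hfg. apply is_RInt_gen_ext.
  eapply filter_imp; [|apply filter_prod_DD]. intros [a b] [H1 H2] x Hx. simpl in *.
  apply Hfg. apply (D_Rmin a b); auto. lra.
Qed.

Lemma is_RInt_gen_sum_n (c : nat -> R -> V) (l : nat -> V) N :
  (forall n, is_RInt_gen (c n) Fa Fb (l n)) ->
  is_RInt_gen (fun x => sum_n (fun n => c n x) N) Fa Fb (sum_n l N).
Proof.
  intros H. induction N.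
  - rewrite sum_O. eapply is_RInt_gen_ext_D; [|apply (H 0%nat)]. intros. now rewrite sum_O.
  - rewrite sum_Sn. eapply is_RInt_gen_ext_D; [|apply (is_RInt_gen_plus (V := V) _ _ _ _ IHN (H
      (S N)))].
    intros. now rewrite sum_Sn.
Qed.

(** Term-by-term integration. The error of the partial sums is uniform relative to an integrable
    weight [g], so after integration it is at most [eps n] times the integral of [g]. *)
Lemma is_series_RInt_gen (f : R -> V) (c : nat -> R -> V) (l : nat -> V) (L : V) (g : R -> R)
    (eps : nat -> R) :
  is_RInt_gen f Fa Fb L -> (forall n, is_RInt_gen (c n) Fa Fb (l n)) ->
  ex_RInt_gen g Fa Fb -> is_lim_seq eps 0 ->
  (forall n x, D x -> norm (minus (sum_n (fun k => c k x) n) (f x)) <= eps n * g x)%R ->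
  is_series l L.
Proof.
  intros Hf Hc [G HG] Heps Hb. unfold is_series.
  apply filterlim_locally_ball_norm. intros e.
  assert (Hlim : is_lim_seq (fun n => eps n * G)%R 0).
  { replace (Finite 0) with (Rbar_mult 0 G) by (simpl; now rewrite Rmult_0_l).
    apply is_lim_seq_scal_r; assumption. }
  destruct (proj2 (is_lim_seq_spec _ _) Hlim e) as [N HN].
  exists N. intros n Hn. unfold ball_norm.
  eapply Rle_lt_trans.
  - apply (RInt_gen_norm_D (fun x => minus (sum_n (fun k => c k x) n) (f x)) (fun x => eps n * g
      x)%R
     _ (eps n * G)%R); [intros; now apply Hb| |].
    + apply (is_RInt_gen_minus (fun x => sum_n (fun k => c k x) n) f); auto.
      now apply is_RInt_gen_sum_n.
    + now apply (is_RInt_gen_scal g).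
  - specialize (HN n Hn). simpl in HN. rewrite Rminus_0_r in HN.
    eapply Rle_lt_trans; [apply Rle_abs|exact HN].
Qed.

End ConvexDomain.

(** * Complex exponential and powers *)

Lemma is_derive_pair (f g : R -> R) x l m : is_derive f x l -> is_derive g x m ->
  is_derive (V := CV) (fun t => (f t, g t)) x (l, m).
Proof.
  intros Hf Hg.
  assert (H := is_derive_plus (V := CV) _ _ _ _ _ (is_derive_scal_l (V := CV) f x l (RtoC 1) Hf)
     (is_derive_scal_l (V := CV) g x m Ci Hg)).
  assert (E : forall a b : R, plus (scal a (RtoC 1) : CV) (scal b Ci) = (a, b)).
  { intros a b. rewrite !scal_R_Cmult. change ((a * 1 + b * Ci)%C = (a, b)).
    apply (injective_projections (A := R) (B := R)); simpl; ring. }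
  rewrite E in H. eapply is_derive_ext; [|exact H]. intros t. apply E.
Qed.

Lemma is_derive_linear {U V : NormedModule R_AbsRing} (T : U -> V) (f : R -> U) x l :
  is_linear T -> is_derive f x l -> is_derive (fun t => T (f t)) x (T l).
Proof.
  intros HT H. unfold is_derive in *.
  eapply filterdiff_ext_lin.
  - apply (filterdiff_comp f T _ T H). apply filterdiff_linear. exact HT.
  - intros y. simpl. apply (linear_scal T HT).
Qed.

Lemma is_derive_Re (f : R -> C) x (l : C) : is_derive (V := CV) f x l -> is_derive (fun t => Re
    (f t)) x (Re l).
Proof.
  apply (is_derive_linear (U := CV) (V := R_NormedModule) (fun z : CV => fst z)), is_linear_fst.
Qed.

Lemma is_derive_Im (f : R -> C) x (l : C) : is_derive (V := CV) f x l -> is_derive (fun t => Im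
    (f t)) x (Im l).
Proof.
  apply (is_derive_linear (U := CV) (V := R_NormedModule) (fun z : CV => snd z)), is_linear_snd.
Qed.

Lemma is_derive_RtoC (f : R -> R) x l : is_derive f x l ->
  is_derive (V := CV) (fun t => RtoC (f t)) x (RtoC l).
Proof. apply (is_derive_linear RtoC), is_linear_RtoC. Qed.

(** Only derivatives in a real variable occur, so the complex product rule is assembled from four
    real ones. *)
Lemma is_derive_Cmult (f g : R -> C) x (l m : C) :
  is_derive (V := CV) f x l -> is_derive (V := CV) g x m ->
  is_derive (V := CV) (fun t => Cmult (f t) (g t)) x (l * g x + f x * m).
Proof.
  intros Hf Hg.
  assert (H1 := is_derive_Re f x l Hf). assert (H2 := is_derive_Im f x l Hf).
  assert (H3 := is_derive_Re g x m Hg). assert (H4 := is_derive_Im g x m Hg).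
  assert (P1 := Derive.is_derive_mult _ _ _ _ _ H1 H3).
  assert (P2 := Derive.is_derive_mult _ _ _ _ _ H2 H4).
  assert (P3 := Derive.is_derive_mult _ _ _ _ _ H1 H4).
  assert (P4 := Derive.is_derive_mult _ _ _ _ _ H2 H3).
  assert (H := is_derive_pair _ _ _ _ _ (is_derive_minus (V := R_NormedModule) _ _ _ _ _ P1 P2)
    (is_derive_plus (V := R_NormedModule) _ _ _ _ _ P3 P4)).
  eapply is_derive_ext; [|replace (l * g x + f x * m) with
    ((minus (Re l * Re (g x) + Re (f x) * Re m) (Im l * Im (g x) + Im (f x) * Im m))%R,
     (plus (Re l * Im (g x) + Re (f x) * Im m) (Im l * Re (g x) + Im (f x) * Re m))%R) ; [exact
         H|]].
  - intros t. apply injective_projections; reflexivity.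
  - apply injective_projections; unfold minus, plus, opp; simpl; unfold Re, Im; ring.
Qed.

Lemma Cexp_plus z w : Cexp (z + w) = Cexp z * Cexp w.
Proof.
  unfold Cexp. destruct z as [a b], w as [c d]. simpl. rewrite exp_plus, cos_plus, sin_plus.
  apply injective_projections; simpl; ring.
Qed.

Lemma Cexp_0 : Cexp 0 = 1.
Proof.
  unfold Cexp. simpl. rewrite exp_0, cos_0, sin_0. apply injective_projections; simpl; ring.
Qed.

Lemma Cexp_RtoC (x : R) : Cexp x = RtoC (exp x).
Proof.
  unfold Cexp. simpl. rewrite cos_0, sin_0. apply injective_projections; simpl; ring.
Qed.

Lemma Cmod_Cexp z : Cmod (Cexp z) = exp (Re z).
Proof.
  unfold Cexp. rewrite Cmod_mult, Cmod_R. unfold Cmod. simpl.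
  replace (cos (Im z) * (cos (Im z) * 1) + sin (Im z) * (sin (Im z) * 1))%R with 1%R.
  - rewrite sqrt_1, Rmult_1_r. apply Rabs_pos_eq. left; apply exp_pos.
  - pose proof (sin2_cos2 (Im z)) as H. unfold Rsqr in H. lra.
Qed.

Lemma Cexp_neq_0 z : Cexp z <> 0.
Proof.
  intros H. pose proof (Cmod_Cexp z) as E. rewrite H, Cmod_0 in E.
  pose proof (exp_pos (Re z)). lra.
Qed.

Lemma Cexp_opp z : Cexp (- z) = / Cexp z.
Proof.
  assert (H : Cexp (-z) * Cexp z = 1). { rewrite <- Cexp_plus. rewrite <- Cexp_0. f_equal. ring. }
  rewrite <- (Cmult_1_r (/ Cexp z)), <- H. field. apply Cexp_neq_0.
Qed.

Lemma is_derive_Cexp (h : R -> C) x (dh : C) : is_derive (V := CV) h x dh ->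
  is_derive (V := CV) (fun t => Cexp (h t)) x (dh * Cexp (h x)).
Proof.
  intros H. assert (H1 := is_derive_Re h x dh H). assert (H2 := is_derive_Im h x dh H).
  assert (E1 := is_derive_comp exp _ x _ _ (is_derive_exp _) H1).
  assert (E2 := is_derive_comp cos _ x _ _ (is_derive_cos _) H2).
  assert (E3 := is_derive_comp sin _ x _ _ (is_derive_sin _) H2).
  assert (K := is_derive_Cmult _ _ _ _ _ (is_derive_RtoC _ _ _ E1) (is_derive_pair _ _ _ _ _ E2
      E3)).
  unfold Cexp.
  replace (dh * (exp (Re (h x)) * (cos (Im (h x)), sin (Im (h x)))))%C with
   (RtoC (scal (Re dh) (exp (Re (h x)))) *
          (cos (Im (h x)), sin (Im (h x))) +
          exp (Re (h x)) *
          (scal (Im dh) (- sin (Im (h x)))%R,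
           scal (Im dh) (cos (Im (h x)))))%C; [exact K|].
  unfold scal; simpl; unfold mult; simpl. apply injective_projections; simpl; unfold Re, Im; ring.
Qed.

Lemma is_derive_Cmult_l (c : C) (f : R -> C) x (l : C) : is_derive (V := CV) f x l ->
  is_derive (V := CV) (fun t => Cmult c (f t)) x (c * l).
Proof. apply (is_derive_linear (U := CV) (V := CV) (Cmult c)), is_linear_Cmult. Qed.

Lemma is_derive_Cplus (f g : R -> C) x (l m : C) :
  is_derive (V := CV) f x l -> is_derive (V := CV) g x m ->
  is_derive (V := CV) (fun t => f t + g t) x (l + m).
Proof. apply (is_derive_plus (V := CV)). Qed.

Lemma is_derive_Cminus (f g : R -> C) x (l m : C) :
  is_derive (V := CV) f x l -> is_derive (V := CV) g x m ->
  is_derive (V := CV) (fun t => f t - g t) x (l - m).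
Proof. apply (is_derive_minus (V := CV)). Qed.

Lemma continuous_of_derive (f : R -> C) x (l : C) : is_derive (V := CV) f x l -> continuous (U :=
    CV) f x.
Proof. intros H. apply (ex_derive_continuous (V := CV)). now exists l. Qed.

Lemma Rcpow_plus a z w : Rcpow a (z + w) = Rcpow a z * Rcpow a w.
Proof. unfold Rcpow. rewrite <- Cexp_plus. f_equal. ring. Qed.

Lemma Rcpow_opp a z : Rcpow a (- z) = / Rcpow a z.
Proof. unfold Rcpow. rewrite <- Cexp_opp. f_equal. ring. Qed.

Lemma Rcpow_0 a : Rcpow a 0 = 1.
Proof. unfold Rcpow. rewrite <- Cexp_0. f_equal. ring. Qed.

Lemma Rcpow_neq_0 a z : Rcpow a z <> 0.
Proof. apply Cexp_neq_0. Qed.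

Lemma Rcpow_minus a z w : Rcpow a (z - w) = Rcpow a z / Rcpow a w.
Proof. unfold Cminus, Cdiv. now rewrite Rcpow_plus, Rcpow_opp. Qed.

Lemma Rcpow_RtoC a (x : R) : Rcpow a x = RtoC (Rpower a x).
Proof. unfold Rcpow, Rpower. now rewrite <- RtoC_mult, Cexp_RtoC. Qed.

Lemma Rcpow_INR a n : (0 < a)%R -> Rcpow a (INR n) = RtoC (a ^ n).
Proof. intros H. now rewrite Rcpow_RtoC, Rpower_pow. Qed.

Lemma Rcpow_1 a : (0 < a)%R -> Rcpow a 1 = RtoC a.
Proof. intros H. now rewrite Rcpow_RtoC, Rpower_1. Qed.

Lemma Rcpow_plus_1 a z : (0 < a)%R -> Rcpow a (z + 1) = Rcpow a z * a.
Proof. intros H. now rewrite Rcpow_plus, Rcpow_1. Qed.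

Lemma Rcpow_mult a b z : (0 < a)%R -> (0 < b)%R -> Rcpow (a * b) z = Rcpow a z * Rcpow b z.
Proof.
  intros Ha Hb. unfold Rcpow. rewrite ln_mult, RtoC_plus, <- Cexp_plus by assumption.
  f_equal. ring.
Qed.

Lemma Cmod_Rcpow a z : Cmod (Rcpow a z) = Rpower a (Re z).
Proof. unfold Rcpow, Rpower. rewrite Cmod_Cexp. f_equal. destruct z; simpl. ring. Qed.

Lemma is_derive_Rcpow (g : R -> R) z x dg : (0 < g x)%R -> is_derive g x dg ->
  is_derive (V := CV) (fun t => Rcpow (g t) z) x (dg * z * Rcpow (g x) (z - 1)).
Proof.
  intros Hp H. unfold Rcpow at 1.
  assert (H1 := is_derive_comp ln _ x _ _ (is_derive_ln _ Hp) H).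
  assert (K := is_derive_Cexp _ _ _ (is_derive_Cmult_l z _ _ _ (is_derive_RtoC _ _ _ H1))).
  replace (dg * z * Rcpow (g x) (z - 1)) with (z * RtoC (scal dg (/ g x)%R) * Cexp (z * RtoC (ln
      (g x)))); [exact K|].
  rewrite Rcpow_minus, Rcpow_1 by assumption.
  change (scal dg (/ g x)%R) with (dg * / g x)%R. rewrite RtoC_mult, RtoC_inv by lra.
  unfold Rcpow. field. intros E. apply RtoC_inj in E. lra.
Qed.

Lemma is_derive_Rpower (g : R -> R) (a : R) x dg : (0 < g x)%R -> is_derive g x dg ->
  is_derive (fun t => Rpower (g t) a) x (dg * a * Rpower (g x) (a - 1))%R.
Proof.
  intros Hp H. assert (K := is_derive_Re _ _ _ (is_derive_Rcpow g a x dg Hp H)).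
  replace (dg * a * Rpower (g x) (a - 1))%R with (Re (dg * a * Rcpow (g x) (a - 1))).
  - eapply is_derive_ext; [|exact K]. intros t. cbv beta. now rewrite Rcpow_RtoC.
  - rewrite <- RtoC_minus, Rcpow_RtoC, <- !RtoC_mult. reflexivity.
Qed.

(** * Remainder of the hyperbolic cosine series *)

(** Equalities arising from lemmas over [CV] are typed in the carrier of that structure; restated at
    type [C] they are accessible to [ring] and [field]. *)
Ltac eq_in_C := match goal with |- @eq _ ?a ?b => change (@eq C a b) end.

(** Both functions start at 0, hence are the integrals of their derivatives, and the bound on the
    derivatives integrates. This is the induction step for the Taylor remainder. *)
Lemma Cmod_le_of_derive (F f : R -> C) (G g : R -> R) t :
  (0 <= t)%R -> F 0%R = RtoC 0 -> G 0%R = 0%R ->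
  (forall s, 0 <= s <= t -> is_derive (V := CV) F s (f s))%R ->
  (forall s, 0 <= s <= t -> continuous (U := CV) f s)%R ->
  (forall s, 0 <= s <= t -> is_derive G s (g s))%R ->
  (forall s, 0 <= s <= t -> continuous g s)%R ->
  (forall s, 0 <= s <= t -> Cmod (f s) <= g s)%R ->
  (Cmod (F t) <= G t)%R.
Proof.
  intros Ht F0 G0 HF Hf HG Hg Hfg.
  assert (E : Rmin 0 t = 0%R /\ Rmax 0 t = t) by (split; [apply Rmin_left | apply Rmax_right];
      lra).
  destruct E as [E1 E2].
  assert (I1 : is_RInt f 0 t (minus (F t) (F 0%R))) by
    (apply (is_RInt_derive (V := CV)); rewrite E1, E2; auto).
  assert (I2 : is_RInt g 0 t (minus (G t) (G 0%R))) by
    (apply (is_RInt_derive (V := R_CompleteNormedModule)); rewrite E1, E2; auto).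
  (* [eq_ind_r] along [norm_C] turns the bound on [Cmod] into the bound on [norm] that is asked
     for. *)
  assert (H := norm_RInt_le (V := CV) f g 0 t _ _ Ht (fun s Hs => eq_ind_r (fun r => (r <= g
      s)%R) (Hfg s Hs) (norm_C (f s))) I1 I2).
  rewrite norm_C, F0, G0 in H.
  unfold minus, plus, opp in H; simpl in H. rewrite Ropp_0, Rplus_0_r in H.
  replace (F t) with (Cplus (F t) (Copp 0)) by ring. exact H.
Qed.

(** The exponential minus the first n terms of its series. Along a ray t z, the derivative of tail n
    + 1 is z times tail n, which makes the remainder accessible to induction. *)
Fixpoint Cexp_tail (n : nat) (z : C) : C :=
  match n with
  | O => Cexp z
  | S m => Cexp_tail m z - z ^ m / RtoC (INR (fact m))
  end.

Lemma INR_fact_neq_0_C n : RtoC (INR (fact n)) <> 0.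
Proof. intros H. apply RtoC_inj in H. now apply (INR_fact_neq_0 n). Qed.

Lemma RtoC_S n : RtoC (INR (S n)) = RtoC (INR n) + 1.
Proof. now rewrite S_INR, RtoC_plus. Qed.

Lemma RtoC_S_neq_0 n : RtoC (INR (S n)) <> 0.
Proof. intros H. apply RtoC_inj in H. now apply (not_0_INR (S n)). Qed.

Lemma is_derive_line (z : C) t : is_derive (V := CV) (fun t : R => t * z) t z.
Proof.
  assert (H := is_derive_scal_l (V := CV) (fun t : R => t) t 1%R z (is_derive_id t)).
  assert (E : scal (1%R : R_AbsRing) (z : CV) = z) by (etransitivity; [apply (scal_R_Cmult 1 z) |
      apply Cmult_1_l]).
  eapply is_derive_ext; [|exact (eq_ind _ (fun w : CV => is_derive (V := CV) _ t w) H _ E)].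
      intros s. apply scal_R_Cmult.
Qed.

Lemma is_derive_Cpow (h : R -> C) x (dh : C) n : is_derive (V := CV) h x dh ->
  is_derive (V := CV) (fun t => Cpow (h t) (S n)) x (INR (S n) * dh * h x ^ n).
Proof.
  intros H. induction n.
  - replace (INR 1 * dh * h x ^ 0)%C with dh by (simpl; eq_in_C; ring).
    eapply is_derive_ext; [|exact H]. intros t. simpl. eq_in_C. ring.
  - assert (K := is_derive_Cmult _ _ _ _ _ H IHn).
    replace (INR (S (S n)) * dh * h x ^ S n)%C with
      (dh * h x ^ (S n) + h x * (INR (S n) * dh * h x ^ n)); [exact K|].
    eq_in_C. rewrite (RtoC_S (S n)). simpl Cpow. ring.
Qed.

Lemma is_derive_Cexp_tail_S n z t :
  is_derive (V := CV) (fun t : R => Cexp_tail (S n) (t * z)) t (z * Cexp_tail n (t * z)).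
Proof.
  induction n.
  - assert (K := is_derive_Cexp _ _ _ (is_derive_line z t)).
    assert (K1 := is_derive_Cminus _ _ _ _ _ K (is_derive_const (V := CV) (1 / 1 : C) t)).
    replace (z * Cexp_tail 0 (t * z)) with (z * Cexp (t * z) - 0); [exact K1|]. simpl. ring.
  - assert (K := is_derive_Cpow _ _ _ n (is_derive_line z t)).
    assert (K1 := is_derive_Cminus _ _ _ _ _ IHn
     (is_derive_Cmult_l (/ INR (fact (S n))) _ _ _ K)).
    eapply is_derive_ext; [|replace (z * Cexp_tail (S n) (t * z)) with
      (z * Cexp_tail n (t * z) - (/ INR (fact (S n)) * (INR (S n) * z * (t * z) ^ n))); [exact
          K1|]].
    + intros s. cbv beta.
      change (Cexp_tail (S (S n)) (s * z)) with (Cexp_tail (S n) (s * z) - (s * z) ^ S n / INR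
          (fact (S n))).
      unfold Cdiv. eq_in_C. ring.
    + change (Cexp_tail (S n) (t * z)) with (Cexp_tail n (t * z) - (t * z) ^ n / INR (fact n)).
      rewrite fact_simpl, mult_INR, RtoC_mult.
      pose proof (RtoC_S_neq_0 n). pose proof (INR_fact_neq_0_C n). field. auto.
Qed.

Lemma Cexp_tail_S_0 n : Cexp_tail (S n) 0 = 0.
Proof.
  induction n.
  - simpl. rewrite Cexp_0. field.
  - change (Cexp_tail (S n) 0 - 0 ^ S n / RtoC (INR (fact (S n))) = 0). rewrite IHn. simpl Cpow.
    unfold Cdiv. ring.
Qed.

Lemma continuous_Cexp_tail n z t : continuous (U := CV) (fun t : R => Cexp_tail n (t * z)) t.
Proof.
  destruct n.
  - eapply continuous_of_derive. apply is_derive_Cexp, is_derive_line.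
  - eapply continuous_of_derive. apply is_derive_Cexp_tail_S.
Qed.

(** Induction on [n], integrating the previous bound from 0 to t. The factor exp |z| dominates |exp
    (t z)| for all t in [0, 1] and therefore stays constant through the induction. *)
Lemma Cexp_tail_bound n z t : (0 <= t <= 1)%R ->
  (Cmod (Cexp_tail n (t * z)) <= exp (Cmod z) * ((t * Cmod z) ^ n / INR (fact n)))%R.
Proof.
  revert t. induction n; intros t Ht.
  - simpl. rewrite Cmod_Cexp. replace (exp (Cmod z) * (1 / 1))%R with (exp (Cmod z)) by field.
    assert (Re (t * z) <= Cmod z)%R.
    { eapply Rle_trans; [apply Rle_abs|]. eapply Rle_trans; [apply re_le_Cmod|].
      rewrite Cmod_mult, Cmod_R, Rabs_pos_eq by lra. pose proof (Cmod_ge_0 z). nra. }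
    destruct H as [H|H]; [left; now apply exp_increasing | rewrite H; lra].
  - apply (Cmod_le_of_derive (fun t : R => Cexp_tail (S n) (t * z)) (fun t : R => z * Cexp_tail n
      (t * z))
     (fun t : R => exp (Cmod z) * ((t * Cmod z) ^ S n / INR (fact (S n))))%R
     (fun t : R => Cmod z * (exp (Cmod z) * ((t * Cmod z) ^ n / INR (fact n))))%R).
    + lra.
    + rewrite Cmult_0_l. apply Cexp_tail_S_0.
    + simpl. unfold Rdiv. ring.
    + intros. apply is_derive_Cexp_tail_S.
    + intros. apply (continuous_comp (V := CV) (W := CV) _ (Cmult z)); [apply
        continuous_Cexp_tail|].
      apply (linear_cont (U := CV) (V := CV)), is_linear_Cmult.
    + intros s _. rewrite fact_simpl, mult_INR.
      pose proof (not_0_INR (S n) ltac:(lia)). pose proof (INR_fact_neq_0 n).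
      replace (Cmod z * (exp (Cmod z) * ((s * Cmod z) ^ n / INR (fact n))))%R with
       (exp (Cmod z) * (INR (S n) * Cmod z * (s * Cmod z) ^ n * / (INR (S n) * INR (fact n))))%R
           by (field; auto).
      apply is_derive_scal. unfold Rdiv.
      apply (is_derive_ext (fun t => scal ((t * Cmod z) ^ S n) (/ (INR (S n) * INR (fact
          n)))))%R; [reflexivity|].
      apply (is_derive_scal_l (V := R_NormedModule)).
      apply (is_derive_pow (fun t => t * Cmod z)%R). auto_derive; auto; ring.
    + intros s _. apply (ex_derive_continuous (V := R_NormedModule)). auto_derive. auto.
    + intros s Hs. rewrite Cmod_mult. apply Rmult_le_compat_l; [apply Cmod_ge_0|]. apply IHn. lra.
Qed.

(** The odd terms of the tails at z and -z cancel. The partial sum stops at degree 2n, so the tails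
    may be taken from degree 2n + 2 on, the term of degree 2n + 1 being odd. *)
Lemma Ccosh_sub_partial_sum n z :
  Ccosh z - sum_n (G := CV) (fun k => z ^ (2 * k) / INR (fact (2 * k))) n =
  (Cexp_tail (2 * S n) z + Cexp_tail (2 * S n) (- z)) / 2.
Proof.
  induction n.
  - rewrite sum_O. unfold Ccosh. simpl. field.
  - rewrite sum_Sn. change (plus (G := CV)) with Cplus.
    replace (2 * S (S n))%nat with (S (S (2 * S n))) by lia.
    change (Cexp_tail (S (S (2 * S n)))) with (fun z => Cexp_tail (2 * S n) z - z ^ (2 * S n) /
        INR (fact (2 * S n)) - z ^ (S (2 * S n)) / INR (fact (S (2 * S n)))).
    cbv beta.
    match goal with |- ?a - (?b + ?c) = _ => replace (a - (b + c)) with ((a - b) - c) by ring end.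
    rewrite IHn.
    replace ((- z) ^ (2 * S n)) with (z ^ (2 * S n)).
    2:{ rewrite !Cpow_mult_r. f_equal. simpl; ring. }
    replace ((- z) ^ (S (2 * S n))) with (- z ^ (S (2 * S n))).
    2:{ change (- (z * z ^ (2 * S n)) = - z * (- z) ^ (2 * S n)). rewrite !Cpow_mult_r. replace
        ((-z)^2) with (z^2); [|simpl]; ring. }
    pose proof (INR_fact_neq_0_C (2 * S n)). pose proof (INR_fact_neq_0_C (S (2 * S n))).
    field. auto.
Qed.

(** Bound for the cosh remainder after the term of degree 2n, uniform on the disc of radius [M]. *)
Definition cosh_err (M : R) (n : nat) : R := (exp M * (M ^ (2 * S n) / INR (fact (2 * S n))))%R.

Lemma Ccosh_remainder (n : nat) (z : C) (M : R) : (Cmod z <= M)%R ->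
  (Cmod (sum_n (G := CV) (fun k => z ^ (2 * k) / INR (fact (2 * k))) n - Ccosh z)%C <= cosh_err M
      n)%R.
Proof.
  intros HM. rewrite <- Cmod_opp.
  replace (- _)%C with (Ccosh z - sum_n (G := CV) (fun k => z ^ (2 * k) / INR (fact (2 * k))) n)
      by ring.
  rewrite Ccosh_sub_partial_sum.
  assert (K : forall w, Cmod w = Cmod z -> (Cmod (Cexp_tail (2 * S n) w) <= cosh_err M n)%R).
  { intros w Hw. replace w with (RtoC 1 * w)%C by ring. eapply Rle_trans; [apply Cexp_tail_bound;
      lra|].
    unfold cosh_err. rewrite Rmult_1_l, Hw. pose proof (Cmod_ge_0 z).
    apply Rmult_le_compat; [left; apply exp_pos | | |].
    - apply Rmult_le_pos; [now apply pow_le | left; apply Rinv_0_lt_compat, INR_fact_lt_0].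
    - destruct HM as [HM|HM]; [left; now apply exp_increasing | rewrite HM; lra].
    - apply Rmult_le_compat_r; [left; apply Rinv_0_lt_compat, INR_fact_lt_0|].
      apply pow_incr. lra. }
  assert (K1 := K z eq_refl). assert (K2 := K (-z) (Cmod_opp z)).
  rewrite Cmod_div by (intros E; apply RtoC_inj in E; lra). rewrite Cmod_R, (Rabs_pos_eq 2) by
      lra.
  assert (K3 := Cmod_triangle (Cexp_tail (2 * S n) z) (Cexp_tail (2 * S n) (-z))). lra.
Qed.

Lemma is_lim_cosh_err M : is_lim_seq (cosh_err M) 0.
Proof.
  unfold cosh_err. replace (Finite 0) with (Rbar_mult (exp M) 0) by (simpl; now rewrite
      Rmult_0_r).
  apply is_lim_seq_scal_l.
  apply (is_lim_seq_subseq (fun n => M ^ n / INR (fact n))%R 0 (fun n => (2 * S n)%nat)).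
  - apply eventually_subseq. intros n. lia.
  - apply is_lim_seq_Reals. exact (cv_speed_pow_fact M).
Qed.

(** Lets the expansion of the cosine use the remainder bound for cosh. *)
Lemma Ccosh_Ci (x : R) : Ccosh (Ci * x) = RtoC (cos x).
Proof.
  unfold Ccosh, Cexp. simpl.
  replace (0 * x - 1 * 0)%R with 0%R by ring. replace (0 * 0 + 1 * x)%R with x by ring.
  rewrite Ropp_0, exp_0, cos_neg, sin_neg.
  rewrite !Cmult_1_l. apply (injective_projections (A := R) (B := R)); simpl; field.
Qed.

(** * Domains and integrable weights *)

(** Closed at 0, where the integrands are regular and the filter is [at_point 0]; open at [u], where
    they may be singular. *)
Definition Dseg (u x : R) : Prop := (0 <= x < u)%R.
Definition Dpos (x : R) : Prop := (0 < x)%R.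

Lemma Dseg_conv u x y z : Dseg u x -> Dseg u y -> (x <= z <= y)%R -> Dseg u z.
Proof. unfold Dseg. lra. Qed.

Lemma Dpos_conv x y z : Dpos x -> Dpos y -> (x <= z <= y)%R -> Dpos z.
Proof. unfold Dpos. lra. Qed.

Lemma Dseg_at_point u : (0 < u)%R -> at_point 0 (Dseg u).
Proof. unfold at_point, Dseg. lra. Qed.

Lemma Dseg_at_left u : (0 < u)%R -> at_left u (Dseg u).
Proof.
  intros Hu. exists (mkposreal u Hu). intros y Hy Hyu.
  unfold ball in Hy; simpl in Hy; unfold AbsRing_ball, abs, minus, plus, opp in Hy; simpl in Hy.
  apply Rabs_def2 in Hy. unfold Dseg. lra.
Qed.

Lemma Dseg_le u : (0 < u)%R -> filter_prod (at_point 0) (at_left u) (fun ab => fst ab <= snd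
    ab)%R.
Proof.
  intros Hu. exists (fun x => x = 0%R) (Dseg u); [reflexivity | now apply Dseg_at_left |].
  intros x y -> [H _]. exact H.
Qed.

Lemma Dpos_at_right : at_right 0 Dpos.
Proof. exists (mkposreal 1 Rlt_0_1). intros y _ Hy. exact Hy. Qed.

Lemma Dpos_p_infty : Rbar_locally p_infty Dpos.
Proof. exists 0%R. intros y Hy. exact Hy. Qed.

Lemma at_right_0_lt (e : R) : (0 < e)%R -> at_right 0 (fun t => t < e)%R.
Proof.
  intros He. exists (mkposreal e He). intros y Hy _.
  unfold ball in Hy; simpl in Hy; unfold AbsRing_ball, abs, minus, plus, opp in Hy; simpl in Hy.
  apply Rabs_def2 in Hy. lra.
Qed.

Lemma Dpos_le : filter_prod (at_right 0) (Rbar_locally p_infty) (fun ab => fst ab <= snd ab)%R.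
Proof.
  exists (fun t => t < 1)%R (fun t => 1 < t)%R.
  - apply at_right_0_lt; lra.
  - exists 1%R. auto.
  - intros x y Hx Hy. simpl. lra.
Qed.

Lemma ln_le_sub_1 x : (0 < x)%R -> (ln x <= x - 1)%R.
Proof. intros H. pose proof (exp_ineq1_le (ln x)) as K. rewrite exp_ln in K; lra. Qed.

Lemma Rpower_pos x a : (0 < Rpower x a)%R.
Proof. apply exp_pos. Qed.

(** Multiply ln (y / a) <= y / a by a and exponentiate. The bound controls the Gamma integrand at
    infinity and the boundary term in the functional equation. *)
Lemma Rpower_le_exp y a : (0 < y)%R -> (0 < a)%R -> (Rpower y a <= Rpower a a * exp y)%R.
Proof.
  intros Hy Ha. unfold Rpower. rewrite <- exp_plus.
  assert (H : (a * ln y <= a * ln a + y)%R).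
  { assert (K : (ln (y / a) <= y / a)%R).
    { eapply Rle_trans; [apply ln_le_sub_1; now apply Rdiv_lt_0_compat | lra]. }
    rewrite ln_div in K by assumption.
    apply (Rmult_le_compat_l a) in K; [|lra]. replace (a * (y / a))%R with y in K by (field;
        lra). lra. }
  destruct H as [H|H]; [left; now apply exp_increasing | rewrite H; lra].
Qed.

Lemma Rpower_lim_0 a : (0 < a)%R -> filterlim (fun t => Rpower t a) (at_right 0) (locally 0%R).
Proof.
  intros Ha. apply filterlim_locally. intros eps.
  (* The radius eps^(1/a) is the exact preimage of eps under t^a. *)
  generalize (filter_and _ _ Dpos_at_right (at_right_0_lt (Rpower eps (/ a)) (Rpower_pos _ _))).
  apply filter_imp. intros t [Ht1 Ht2]. unfold Dpos in Ht1.
  change (Rabs (Rpower t a - 0) < eps)%R. rewrite Rminus_0_r, Rabs_pos_eq by (left; apply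
      Rpower_pos).
  replace (pos eps) with (Rpower (Rpower eps (/ a)) a).
  - now apply Rlt_Rpower_l.
  - rewrite Rpower_mult, Rinv_l, Rpower_1; [reflexivity | apply cond_pos | lra].
Qed.

(** [Rpower t a] is 1 for t <= 0, because [ln] is 0 there. It tends to 0 only when 0 is approached
    from the right, so the sign of the inner function has to be recorded along with its limit. *)
Lemma at_left_to_at_right (h : R -> R) u : continuous h u -> h u = 0%R ->
  at_left u (fun x => 0 < h x)%R -> filterlim h (at_left u) (at_right 0).
Proof.
  intros Hc H0 Hp P [eps HP].
  assert (K : locally u (fun x => ball 0%R eps (h x))).
  { rewrite <- H0. apply Hc. now exists eps. }
  assert (K' : at_left u (fun x => ball 0%R eps (h x))).
  { apply filter_le_within. exact K. }
  unfold filtermap. eapply filter_imp; [|exact (filter_and _ _ K' Hp)].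
  intros x [K1 K2]. apply HP; auto.
Qed.

Lemma filterlim_C_0 {T} (F : (T -> Prop) -> Prop) {FF : Filter F} (f : T -> C) (g : T -> R) :
  F (fun x => Cmod (f x) <= g x)%R -> filterlim g F (locally 0%R) ->
  filterlim (f : T -> CV) F (locally (RtoC 0 : CV)).
Proof.
  intros Hfg Hg. apply (filterlim_locally_ball_norm (U := CV) f (RtoC 0)). intros eps.
  assert (Hg' := proj1 (filterlim_locally (U := R_UniformSpace) g 0%R) Hg eps).
  eapply filter_imp; [|exact (filter_and _ _ Hfg Hg')].
  intros x [H1 H2]. unfold ball_norm. rewrite norm_C.
  apply Rle_lt_trans with (Cmod (f x)).
  { right. apply f_equal. change (f x + - 0 = f x). ring. }
  change (Rabs (g x - 0) < eps)%R in H2. rewrite Rminus_0_r in H2.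
  apply Rabs_def2 in H2. lra.
Qed.

Lemma filterlim_at_point {V : UniformSpace} (f : R -> V) a : filterlim f (at_point a) (locally (f
    a)).
Proof. intros P HP. exact (locally_singleton _ _ HP). Qed.

Lemma sq_sub_pos u x : Dseg u x -> (0 < u ^ 2 - x ^ 2)%R.
Proof. unfold Dseg. intros H. nra. Qed.

Lemma is_derive_sq_sub u x : is_derive (fun x => u ^ 2 - x ^ 2)%R x (- 2 * x)%R.
Proof. auto_derive; auto. ring. Qed.

Lemma sq_sub_lim u : (0 < u)%R -> filterlim (fun x => u ^ 2 - x ^ 2)%R (at_left u) (at_right 0).
Proof.
  intros Hu. apply at_left_to_at_right.
  - apply (ex_derive_continuous (V := R_NormedModule)). eexists. apply is_derive_sq_sub.
  - ring.
  - eapply filter_imp; [|exact (Dseg_at_left u Hu)]. intros x. apply sq_sub_pos.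
Qed.

(** In u^2 - x^2 = (u + x)(u - x) the first factor stays between u and 2u, so its power is bounded;
    the power of the second has the primitive -(u - x)^a / a. *)
Lemma ex_RInt_gen_sq_sub_Rpower u a : (0 < u)%R -> (0 < a)%R ->
  ex_RInt_gen (fun x => Rpower (u ^ 2 - x ^ 2) (a - 1))%R (at_point 0) (at_left u).
Proof.
  intros Hu Ha.
  (* The larger endpoint value of (u + x)^(a - 1) depends on the sign of a - 1; their sum covers
     both cases. *)
  set (K := (Rpower u (a - 1) + Rpower (2 * u) (a - 1))%R).
  assert (HD : forall x, Dseg u x -> is_derive (fun t => - (K / a) * Rpower (u - t) a)%R x (K *
      Rpower (u - x) (a - 1))%R).
  { intros x Hx. unfold Dseg in Hx.
    assert (H : is_derive (fun t => u - t)%R x (-1)%R) by (auto_derive; auto; ring).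
    replace (K * Rpower (u - x) (a - 1))%R with (- (K / a) * (-1 * a * Rpower (u - x) (a - 1)))%R
        by (field; lra).
    apply is_derive_scal. apply is_derive_Rpower; [lra | exact H]. }
  assert (HC : forall x, Dseg u x -> continuous (fun x => K * Rpower (u - x) (a - 1))%R x).
  { intros x Hx. unfold Dseg in Hx. apply (ex_derive_continuous (V := R_NormedModule)). eexists.
    apply is_derive_scal. apply (is_derive_Rpower (fun t => u - t)%R _ _ (-1)); [lra|].
        auto_derive; auto; ring. }
  apply (ex_RInt_gen_dominated (V := R_CompleteNormedModule) (Dseg u) (Dseg_conv u)
      (Dseg_at_point u Hu) (Dseg_at_left u Hu)
    _ (fun x => K * Rpower (u - x) (a - 1))%R).
  - intros x Hx. apply (ex_derive_continuous (V := R_NormedModule)). eexists.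
    apply is_derive_Rpower; [now apply sq_sub_pos | apply is_derive_sq_sub].
  - exact HC.
  - intros x Hx. change (norm (Rpower (u ^ 2 - x ^ 2) (a - 1))) with (Rabs (Rpower (u ^ 2 - x ^
      2) (a - 1))).
    rewrite Rabs_pos_eq by (left; apply Rpower_pos). unfold Dseg in Hx.
    replace (u ^ 2 - x ^ 2)%R with ((u + x) * (u - x))%R by ring.
    rewrite <- Rpower_mult_distr by lra.
    apply Rmult_le_compat_r; [left; apply Rpower_pos|]. unfold K.
    destruct (Rle_dec 0 (a - 1)) as [H|H].
    + assert (Rpower (u + x) (a - 1) <= Rpower (2 * u) (a - 1))%R by (apply Rle_Rpower_l; lra).
      pose proof (Rpower_pos u (a - 1)). lra.
    + assert (Rpower (u + x) (a - 1) <= Rpower u (a - 1))%R.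
      { replace (a - 1)%R with (- (1 - a))%R by ring. rewrite !Rpower_Ropp. apply
          Rinv_le_contravar; [apply Rpower_pos|]. apply Rle_Rpower_l; lra. }
      pose proof (Rpower_pos (2 * u) (a - 1)). lra.
  - eexists. apply (is_RInt_gen_derive (V := R_CompleteNormedModule) (Dseg u) (Dseg_conv u)
      (Dseg_at_point u Hu) (Dseg_at_left u Hu) _ _ (- (K / a) * Rpower (u - 0) a)%R (- (K / a) *
      0)%R HD HC).
    + apply (filterlim_at_point (V := R_UniformSpace) (fun t => - (K / a) * Rpower (u - t) a)%R
        0%R).
    + eapply filterlim_comp; [|apply (filterlim_scal_r (V := R_NormedModule) (- (K / a))%R 0%R)].
      apply (filterlim_comp _ _ _ (fun t => u - t)%R (fun t => Rpower t a) _ (at_right 0));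
          [|apply Rpower_lim_0, Ha].
      apply at_left_to_at_right; [|ring|].
      * apply (ex_derive_continuous (V := R_NormedModule)). auto_derive. auto.
      * eapply filter_imp; [|exact (Dseg_at_left u Hu)]. intros x. unfold Dseg. lra.
Qed.

(** * The integrals of x^(2k) (1 - x^2)^(s-1) *)

Lemma Re_minus_1 (s : C) : Re (s - 1) = (Re s - 1)%R.
Proof. reflexivity. Qed.

Lemma Re_plus_R (s : C) (a : R) : Re (s + a) = (Re s + a)%R.
Proof. reflexivity. Qed.

Lemma is_RInt_gen_RInt_gen (f : R -> C) Fa Fb {FFa : ProperFilter Fa} {FFb : ProperFilter Fb} :
  ex_RInt_gen (V := CV) f Fa Fb -> is_RInt_gen (V := CV) f Fa Fb (RInt_gen (V := CV) f Fa Fb).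
Proof. apply (RInt_gen_correct (V := CV)). Qed.

Lemma is_RInt_gen_Cmult (c : C) (f : R -> C) Fa Fb {FFa : Filter Fa} {FFb : Filter Fb} (l : C) :
  is_RInt_gen (V := CV) f Fa Fb l -> is_RInt_gen (V := CV) (fun x => c * f x) Fa Fb (c * l).
Proof. intros H. exact (is_RInt_gen_linear (U := CV) (V := CV) (Cmult c) f Fa Fb l
    (is_linear_Cmult c) H). Qed.

Lemma ex_RInt_gen_seg u a K (f : R -> C) : (0 < u)%R -> (0 < a)%R ->
  (forall x, Dseg u x -> continuous (U := CV) f x) ->
  (forall x, Dseg u x -> Cmod (f x) <= K * Rpower (u ^ 2 - x ^ 2) (a - 1))%R ->
  ex_RInt_gen (V := CV) f (at_point 0) (at_left u).
Proof.
  intros Hu Ha Hf HK.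
  apply (ex_RInt_gen_dominated (V := CV) (Dseg u) (Dseg_conv u) (Dseg_at_point u Hu)
      (Dseg_at_left u Hu)
    _ (fun x => K * Rpower (u ^ 2 - x ^ 2) (a - 1))%R); auto.
  - intros x Hx. apply (ex_derive_continuous (V := R_NormedModule)). eexists.
    apply is_derive_scal. apply is_derive_Rpower; [now apply sq_sub_pos | apply is_derive_sq_sub].
  - intros x Hx. rewrite norm_C. now apply HK.
  - destruct (ex_RInt_gen_sq_sub_Rpower u a Hu Ha) as [l Hl].
    eexists. apply (is_RInt_gen_scal (V := R_NormedModule) _ K _ Hl).
Qed.

Lemma is_derive_sq_sub_Rcpow u s x : Dseg u x ->
  is_derive (V := CV) (fun x => Rcpow (u ^ 2 - x ^ 2) s) x (RtoC (- 2 * x)%R * s * Rcpow (u ^ 2 -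
      x ^ 2) (s - 1)).
Proof. intros Hx. apply (is_derive_Rcpow (fun x => u ^ 2 - x ^ 2)%R); [now apply sq_sub_pos |
    apply is_derive_sq_sub]. Qed.

Lemma is_derive_RtoC_pow n (x : R) :
  is_derive (V := CV) (fun x => RtoC (x ^ S n)) x (RtoC (INR (S n) * x ^ n)).
Proof.
  apply is_derive_RtoC.
  replace (INR (S n) * x ^ n)%R with (INR (S n) * 1 * x ^ n)%R by ring.
  apply (is_derive_pow (fun x => x) (S n) x 1%R). apply (is_derive_id (K := R_AbsRing)).
Qed.

Definition beta_f u k s (x : R) : C := RtoC (x ^ (2 * k)) * Rcpow (u ^ 2 - x ^ 2) (s - 1).

Lemma continuous_beta_f u k s x : Dseg u x -> continuous (U := CV) (beta_f u k s) x.
Proof.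
  intros Hx. destruct k.
  - apply (continuous_ext (U := CV) (fun x => Rcpow (u ^ 2 - x ^ 2) (s - 1))).
    { intros t. unfold beta_f. simpl pow at 3. symmetry. apply Cmult_1_l. }
    eapply continuous_of_derive. now apply is_derive_sq_sub_Rcpow.
  - unfold beta_f. replace (2 * S k)%nat with (S (S (2 * k))) by lia.
    eapply continuous_of_derive. apply is_derive_Cmult; [apply is_derive_RtoC_pow | now apply
        is_derive_sq_sub_Rcpow].
Qed.

Lemma ex_RInt_gen_beta_f u k s : (0 < u)%R -> (0 < Re s)%R ->
  ex_RInt_gen (V := CV) (beta_f u k s) (at_point 0) (at_left u).
Proof.
  intros Hu Hs. apply (ex_RInt_gen_seg u (Re s) (u ^ (2 * k))); auto.
  - intros x. apply continuous_beta_f.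
  - intros x Hx. unfold beta_f. rewrite Cmod_mult, Cmod_R, Cmod_Rcpow, Re_minus_1.
    apply Rmult_le_compat_r; [left; apply Rpower_pos|]. unfold Dseg in Hx.
    rewrite Rabs_pos_eq by (apply pow_le; lra). apply pow_incr. lra.
Qed.

Definition beta_int (k : nat) (s : C) : C := RInt_gen (V := CV) (beta_f 1 k s) (at_point 0)
    (at_left 1).

Lemma beta_int_is k s : (0 < Re s)%R -> is_RInt_gen (V := CV) (beta_f 1 k s) (at_point 0)
    (at_left 1) (beta_int k s).
Proof. intros Hs. exact (is_RInt_gen_RInt_gen _ _ _ (ex_RInt_gen_beta_f 1 k s Rlt_0_1 Hs)). Qed.

Lemma is_RInt_gen_unique_C (f : R -> C) Fa Fb {FFa : ProperFilter Fa} {FFb : ProperFilter Fb} (l1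
    l2 : C) :
  is_RInt_gen (V := CV) f Fa Fb l1 -> is_RInt_gen (V := CV) f Fa Fb l2 -> l1 = l2.
Proof.
  intros H1 H2. apply (is_RInt_gen_unique (V := CV) f l1) in H1; apply (is_RInt_gen_unique (V :=
      CV) f l2) in H2; try typeclasses eauto.
  now rewrite <- H1, <- H2.
Qed.

(** The extra factor 1 - x^2 is multiplied out. *)
Lemma beta_int_shift k s : (0 < Re s)%R -> beta_int k (s + 1) = beta_int k s - beta_int (S k) s.
Proof.
  intros Hs. apply (is_RInt_gen_unique_C (beta_f 1 k (s + 1)) (at_point 0) (at_left 1)).
  - apply beta_int_is. rewrite Re_plus_R. lra.
  - eapply (is_RInt_gen_ext_D (Dseg 1) (Dseg_conv 1) (Dseg_at_point 1 Rlt_0_1) (Dseg_at_left 1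
      Rlt_0_1));
      [|apply (is_RInt_gen_minus (V := CV) _ _ _ _ (beta_int_is k s Hs) (beta_int_is (S k) s
          Hs))].
    intros x Hx. change (beta_f 1 k s x - beta_f 1 (S k) s x = beta_f 1 k (s + 1) x). unfold
        beta_f.
    replace (s + 1 - 1) with (s - 1 + 1) by ring. rewrite Rcpow_plus_1 by now apply sq_sub_pos.
    replace (2 * S k)%nat with (2 * k + 2)%nat by lia. rewrite pow_add, RtoC_minus, RtoC_mult.
    rewrite pow1. ring.
Qed.

(** Integration by parts with x^(2k+1) (1 - x^2)^s, which vanishes at 0 because 2k + 1 > 0 and at 1
    because Re s > 0. Together with [beta_int_shift] it gives the recursions in [k] and in [s]. *)
Lemma beta_int_parts k s : (0 < Re s)%R -> RtoC (INR (2 * k + 1)) * beta_int k (s + 1) = 2 * s *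
    beta_int (S k) s.
Proof.
  intros Hs.
  assert (H : is_RInt_gen (V := CV) (fun x => RtoC (INR (2 * k + 1)) * beta_f 1 k (s + 1) x - 2 *
      s * beta_f 1 (S k) s x) (at_point 0) (at_left 1) (minus (0 : C) (0 : C) : CV)).
  { apply (is_RInt_gen_derive (V := CV) (Dseg 1) (Dseg_conv 1) (Dseg_at_point 1 Rlt_0_1)
      (Dseg_at_left 1 Rlt_0_1) (fun x => RtoC (x ^ (S (2 * k))) * Rcpow (1 ^ 2 - x ^ 2) s)).
    - intros x Hx.
      replace (RtoC (INR (2 * k + 1)) * beta_f 1 k (s + 1) x - 2 * s * beta_f 1 (S k) s x) with
        (RtoC (INR (S (2 * k)) * x ^ (2 * k)) * Rcpow (1 ^ 2 - x ^ 2) s + RtoC (x ^ S (2 * k)) *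
            (RtoC (- 2 * x)%R * s * Rcpow (1 ^ 2 - x ^ 2) (s - 1))).
      + apply (is_derive_Cmult (fun x => RtoC (x ^ S (2 * k))) (fun x => Rcpow (1 ^ 2 - x ^ 2)
          s)); [apply is_derive_RtoC_pow | now apply is_derive_sq_sub_Rcpow].
      + unfold beta_f. replace (s + 1 - 1) with s by ring.
        replace (2 * S k)%nat with (S (S (2 * k))) by lia.
        replace (2 * k + 1)%nat with (S (2 * k)) by lia.
        change (x ^ S (S (2 * k)))%R with (x * x ^ S (2 * k))%R. replace (- 2 * x)%R with (- (2 *
            x))%R by ring. rewrite RtoC_opp, !RtoC_mult. ring.
    - intros x Hx.
      apply (continuous_minus (V := CV) (fun x => RtoC (INR (2 * k + 1)) * beta_f 1 k (s + 1) x)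
          (fun x => 2 * s * beta_f 1 (S k) s x)).
      + apply (continuous_comp (V := CV) (W := CV) _ (Cmult (RtoC (INR (2 * k + 1))))); [now
          apply continuous_beta_f|].
        apply (linear_cont (U := CV) (V := CV)), is_linear_Cmult.
      + apply (continuous_comp (V := CV) (W := CV) _ (Cmult (2 * s))); [now apply
          continuous_beta_f|].
        apply (linear_cont (U := CV) (V := CV)), is_linear_Cmult.
    - pose proof (filterlim_at_point (V := CV) (fun x => RtoC (x ^ (S (2 * k))) * Rcpow (1 ^ 2 -
        x ^ 2) s) 0%R) as K.
      cbv beta in K. rewrite pow_i in K by lia. rewrite Cmult_0_l in K. exact K.
    - apply (filterlim_C_0 (at_left 1) _ (fun x => Rpower (1 ^ 2 - x ^ 2) (Re s))).
      + eapply filter_imp; [|exact (Dseg_at_left 1 Rlt_0_1)]. intros x Hx. unfold Dseg in Hx.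
        rewrite Cmod_mult, Cmod_R, Cmod_Rcpow, Rabs_pos_eq by (apply pow_le; lra).
        rewrite <- (Rmult_1_l (Rpower _ _)) at 2. apply Rmult_le_compat_r; [left; apply
            Rpower_pos|].
        rewrite <- (pow1 (S (2 * k))). apply pow_incr. lra.
      + apply (filterlim_comp _ _ _ (fun x => 1 ^ 2 - x ^ 2)%R (fun t => Rpower t (Re s)) _
          (at_right 0));
        [apply sq_sub_lim, Rlt_0_1 | now apply Rpower_lim_0]. }
  assert (A1 := is_RInt_gen_Cmult (RtoC (INR (2 * k + 1))) _ (at_point 0) (at_left 1) _
      (beta_int_is k (s + 1) ltac:(rewrite Re_plus_R; lra))).
  assert (A2 := is_RInt_gen_Cmult (2 * s) _ (at_point 0) (at_left 1) _ (beta_int_is (S k) s Hs)).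
  assert (H2 := is_RInt_gen_minus (V := CV) (Fa := at_point 0) (Fb := at_left 1) _ _ _ _ A1 A2).
  assert (E := is_RInt_gen_unique_C _ (at_point 0) (at_left 1) _ _ H H2).
  change (0 + - 0 = RtoC (INR (2 * k + 1)) * beta_int k (s + 1) - 2 * s * beta_int (S k) s) in E.
  apply (proj2 (Ceq_minus _ _)). rewrite <- E. ring.
Qed.

(** * The Gamma integral *)

Lemma filterlim_div_1_plus_at_right_0 : filterlim (fun t => t / (1 + t))%R (at_right 0) (at_right
    0).
Proof.
  intros P [eps HP].
  assert (K := filter_and _ _ Dpos_at_right (at_right_0_lt eps (cond_pos eps))).
  unfold filtermap. eapply filter_imp; [|exact K].
  intros t [H1 H2]. unfold Dpos in H1.
  assert (H3 : (0 < t / (1 + t))%R) by (apply Rdiv_lt_0_compat; lra).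
  apply HP; [|exact H3].
  change (Rabs (t / (1 + t) - 0) < eps)%R. rewrite Rminus_0_r, Rabs_pos_eq by lra.
  apply Rle_lt_trans with t; [|lra].
  apply Rmult_le_reg_r with (1 + t)%R; [lra|]. replace (t / (1 + t) * (1 + t))%R with t by
      (field; lra). nra.
Qed.

Lemma filterlim_div_at_p_infty (a : R) : (0 <= a)%R -> filterlim (fun t => a / t)%R (Rbar_locally
    p_infty) (locally 0%R).
Proof.
  intros Ha. apply filterlim_locally. intros eps.
  exists (a / eps)%R. intros t Ht. pose proof (cond_pos eps) as He.
  assert (0 <= a / eps)%R by (apply Rmult_le_pos; [lra | left; now apply Rinv_0_lt_compat]).
  change (Rabs (a / t - 0) < eps)%R. rewrite Rminus_0_r.
  assert (H0 : (0 < t)%R) by lra.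
  rewrite Rabs_pos_eq by (apply Rmult_le_pos; [lra | left; now apply Rinv_0_lt_compat]).
  apply Rmult_lt_reg_r with t; [exact H0|]. replace (a / t * t)%R with a by (field; lra).
  apply (Rmult_lt_compat_r eps) in Ht; [|exact He]. replace (a / eps * eps)%R with a in Ht by
      (field; lra). lra.
Qed.

Lemma filterlim_div_1_plus_p_infty : filterlim (fun t => t / (1 + t))%R (Rbar_locally p_infty)
    (locally 1%R).
Proof.
  apply filterlim_locally. intros eps.
  assert (K := proj1 (filterlim_locally (U := R_UniformSpace) _ _) (filterlim_div_at_p_infty 1
      Rle_0_1) eps).
  eapply filter_imp; [|exact (filter_and _ _ Dpos_p_infty K)].
  intros t [H1 H2]. unfold Dpos in H1.
  change (Rabs (1 / t - 0) < eps)%R in H2. change (Rabs (t / (1 + t) - 1) < eps)%R.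
  replace (t / (1 + t) - 1)%R with (- (1 / (1 + t)))%R by (field; lra). rewrite Rabs_Ropp.
  rewrite Rminus_0_r in H2. rewrite Rabs_pos_eq in * by (left; apply Rdiv_lt_0_compat; lra).
  eapply Rle_lt_trans; [|exact H2]. apply Rmult_le_compat_l; [lra|]. apply Rinv_le_contravar; lra.
Qed.

(* The derivative of [(t / (1 + t))^a], so its improper integral is explicit. *)
Definition gamma_dom (a t : R) : R := (/ (1 + t) ^ 2 * a * Rpower (t / (1 + t)) (a - 1))%R.

Lemma is_derive_div_1_plus t : Dpos t -> is_derive (fun t => t / (1 + t))%R t (/ (1 + t) ^ 2)%R.
Proof. unfold Dpos; intros H. auto_derive; [lra | field; lra]. Qed.

Lemma div_1_plus_pos t : Dpos t -> (0 < t / (1 + t))%R.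
Proof. unfold Dpos; intros H. apply Rdiv_lt_0_compat; lra. Qed.

Lemma continuous_gamma_dom a t : Dpos t -> continuous (gamma_dom a) t.
Proof.
  intros Ht. unfold gamma_dom.
  apply (continuous_mult (K := R_AbsRing) (fun t => / (1 + t) ^ 2 * a)%R (fun t => Rpower (t / (1
      + t)) (a - 1))).
  - apply (ex_derive_continuous (V := R_NormedModule)). unfold Dpos in Ht. auto_derive. apply
      Rgt_not_eq. nra.
  - apply (ex_derive_continuous (V := R_NormedModule)). eexists.
    apply (is_derive_Rpower (fun t => t / (1 + t))%R); [now apply div_1_plus_pos | now apply
        is_derive_div_1_plus].
Qed.

Lemma ex_RInt_gen_gamma_dom a : (0 < a)%R ->
  ex_RInt_gen (gamma_dom a) (at_right 0) (Rbar_locally p_infty).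
Proof.
  intros Ha. eexists.
  apply (is_RInt_gen_derive (V := R_CompleteNormedModule) Dpos Dpos_conv Dpos_at_right
      Dpos_p_infty
    (fun t => Rpower (t / (1 + t)) a) (gamma_dom a) 0%R (Rpower 1 a)).
  - intros t Ht. apply (is_derive_Rpower (fun t => t / (1 + t))%R); [now apply div_1_plus_pos |
      now apply is_derive_div_1_plus].
  - apply continuous_gamma_dom.
  - apply (filterlim_comp _ _ _ (fun t => t / (1 + t))%R (fun t => Rpower t a) _ (at_right 0));
      [apply filterlim_div_1_plus_at_right_0 | now apply Rpower_lim_0].
  - apply (filterlim_comp _ _ _ (fun t => t / (1 + t))%R (fun t => Rpower t a) _ (locally 1%R));
      [apply filterlim_div_1_plus_p_infty |].
    change (continuous (fun t => Rpower t a) 1%R). apply (ex_derive_continuous (V :=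
        R_NormedModule)). eexists.
    apply (is_derive_Rpower (fun t => t)); [lra | apply (is_derive_id (K := R_AbsRing))].
Qed.

Definition gamma_f (s : C) (t : R) : C := Rcpow t (s - RtoC 1) * RtoC (exp (- t)).

Lemma is_derive_Rcpow_exp s t : Dpos t ->
  is_derive (V := CV) (fun t => Rcpow t s * RtoC (exp (- t))) t (s * Rcpow t (s - 1) * RtoC (exp
      (- t)) - Rcpow t s * RtoC (exp (- t))).
Proof.
  intros Ht.
  assert (H1 := is_derive_Rcpow (fun t => t) s t 1%R Ht (is_derive_id (K := R_AbsRing) t)).
  assert (H2 : is_derive (V := CV) (fun t => RtoC (exp (- t))) t (RtoC (- exp (- t))%R)).
  { apply is_derive_RtoC. auto_derive; auto. ring. }
  replace (s * Rcpow t (s - 1) * RtoC (exp (- t)) - Rcpow t s * RtoC (exp (- t))) with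
   (1 * s * Rcpow t (s - 1) * RtoC (exp (- t)) + Rcpow t s * RtoC (- exp (- t))%R); [exact
       (is_derive_Cmult _ _ _ _ _ H1 H2)|].
  rewrite RtoC_opp. ring.
Qed.

Lemma continuous_gamma_f s t : Dpos t -> continuous (U := CV) (gamma_f s) t.
Proof. intros Ht. eapply continuous_of_derive. now apply is_derive_Rcpow_exp. Qed.

Lemma Cmod_gamma_f s t : Cmod (gamma_f s t) = (Rpower t (Re s - 1) * exp (- t))%R.
Proof.
  unfold gamma_f. rewrite Cmod_mult, Cmod_R, Cmod_Rcpow, Re_minus_1, Rabs_pos_eq; [reflexivity|].
  left; apply exp_pos.
Qed.

(** [gamma_dom a t] equals a t^(a-1) (1 + t)^(-a-1): it behaves like t^(a-1) at 0 and like t^(-2) at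
    infinity, so one explicit function handles both ends. *)
Lemma ex_RInt_gen_gamma_f s : (0 < Re s)%R ->
  ex_RInt_gen (V := CV) (gamma_f s) (at_right 0) (Rbar_locally p_infty).
Proof.
  intros Hs. set (a := Re s) in *.
  (* The factor 1/a cancels the a in [gamma_dom]; the rest is the constant in (1 + t)^(a+1) <=
     (a+1)^(a+1) e^(1+t). *)
  set (K := (/ a * Rpower (a + 1) (a + 1) * exp 1)%R).
  apply (ex_RInt_gen_dominated (V := CV) Dpos Dpos_conv Dpos_at_right Dpos_p_infty _ (fun t => K
      * gamma_dom a t)%R).
  - apply continuous_gamma_f.
  - intros t Ht. apply (continuous_scal_r (V := R_NormedModule) K (gamma_dom a)). now apply
      continuous_gamma_dom.
  - intros t Ht. rewrite norm_C, Cmod_gamma_f. fold a.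
    unfold gamma_dom. unfold Dpos in Ht.
    assert (E : Rpower (t / (1 + t)) (a - 1) = (Rpower t (a - 1) * (1 + t) ^ 2 * / Rpower (1 + t)
        (a + 1))%R).
    { unfold Rdiv. rewrite <- Rpower_mult_distr by (try apply Rinv_0_lt_compat; lra).
      rewrite Rmult_assoc. f_equal.
      rewrite <- (Rpower_pow 2) by lra. rewrite <- (Rpower_Ropp (1 + t) (a + 1)), <- Rpower_plus.
      unfold Rpower. rewrite ln_Rinv by lra. f_equal. simpl. ring. }
    rewrite E. unfold K.
    replace (/ a * Rpower (a + 1) (a + 1) * exp 1 * (/ (1 + t) ^ 2 * a * (Rpower t (a - 1) * (1 +
        t) ^ 2 * / Rpower (1 + t) (a + 1))))%R
     with (Rpower t (a - 1) * (Rpower (a + 1) (a + 1) * exp 1 * / Rpower (1 + t) (a + 1)))%R.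
    2:{ field. pose proof (Rpower_pos (1 + t) (a + 1)). lra. }
    apply Rmult_le_compat_l; [left; apply Rpower_pos|].
    assert (B := Rpower_le_exp (1 + t) (a + 1) ltac:(lra) ltac:(lra)). rewrite exp_plus in B.
    assert (P := Rpower_pos (1 + t) (a + 1)).
    rewrite exp_Ropp. assert (Q := exp_pos t).
    apply Rmult_le_reg_r with (exp t * Rpower (1 + t) (a + 1))%R; [now apply Rmult_lt_0_compat|].
    replace (/ exp t * (exp t * Rpower (1 + t) (a + 1)))%R with (Rpower (1 + t) (a + 1)) by
        (field; lra).
    replace (Rpower (a + 1) (a + 1) * exp 1 * / Rpower (1 + t) (a + 1) * (exp t * Rpower (1 + t)
        (a + 1)))%R with
      (Rpower (a + 1) (a + 1) * (exp 1 * exp t))%R by (field; lra). exact B.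
  - destruct (ex_RInt_gen_gamma_dom a Hs) as [l Hl]. eexists.
    apply (is_RInt_gen_scal (V := R_NormedModule) _ K _ Hl).
Qed.

Lemma Gamma_int_is s : (0 < Re s)%R ->
  is_RInt_gen (V := CV) (gamma_f s) (at_right 0) (Rbar_locally p_infty) (Gamma_int s).
Proof. intros Hs. exact (is_RInt_gen_RInt_gen _ _ _ (ex_RInt_gen_gamma_f s Hs)). Qed.

Lemma Gamma_eq_Gamma_int s : (0 < Re s)%R -> Gamma s = Gamma_int s.
Proof.
  intros Hs. unfold Gamma.
  (* [up] gives an integer at most 0 here, and [Z.to_nat] sends negative integers to 0. *)
  assert (Z.to_nat (up (- Re s)) = 0%nat) as ->; [|reflexivity].
  destruct (archimed (- Re s)) as [_ H].
  assert (IZR (up (- Re s)) < 1)%R by lra. apply lt_IZR in H0. lia.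
Qed.

(** Integration by parts with t^s e^(-t), which tends to 0 at both ends because Re s > 0. *)
Lemma Gamma_int_succ s : (0 < Re s)%R -> Gamma_int (s + 1) = s * Gamma_int s.
Proof.
  intros Hs.
  assert (H : is_RInt_gen (V := CV) (fun t => s * gamma_f s t - gamma_f (s + 1) t) (at_right 0)
      (Rbar_locally p_infty) (minus (0 : C) (0 : C) : CV)).
  { apply (is_RInt_gen_derive (V := CV) Dpos Dpos_conv Dpos_at_right Dpos_p_infty (fun t => Rcpow
      t s * RtoC (exp (- t)))).
    - intros t Ht.
      replace (s * gamma_f s t - gamma_f (s + 1) t) with (s * Rcpow t (s - 1) * RtoC (exp (- t))
          - Rcpow t s * RtoC (exp (- t))).
      + now apply is_derive_Rcpow_exp.
      + unfold gamma_f. replace (s + 1 - 1) with s by ring. ring.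
    - intros t Ht. apply (continuous_minus (V := CV) (fun t => s * gamma_f s t) (gamma_f (s +
        1))).
      + apply (continuous_comp (V := CV) (W := CV) _ (Cmult s)); [now apply continuous_gamma_f|].
        apply (linear_cont (U := CV) (V := CV)), is_linear_Cmult.
      + now apply continuous_gamma_f.
    - apply (filterlim_C_0 (at_right 0) _ (fun t => Rpower t (Re s))).
      + eapply filter_imp; [|exact Dpos_at_right]. intros t Ht. unfold Dpos in Ht.
        rewrite Cmod_mult, Cmod_R, Cmod_Rcpow, Rabs_pos_eq by (left; apply exp_pos).
        rewrite <- (Rmult_1_r (Rpower _ _)) at 2. apply Rmult_le_compat_l; [left; apply
            Rpower_pos|].
        rewrite <- exp_0. left. apply exp_increasing. lra.
      + now apply Rpower_lim_0.
    - apply (filterlim_C_0 (Rbar_locally p_infty) _ (fun t => Rpower (Re s + 1) (Re s + 1) /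
        t)%R).
      + eapply filter_imp; [|exact Dpos_p_infty]. intros t Ht. unfold Dpos in Ht.
        rewrite Cmod_mult, Cmod_R, Cmod_Rcpow, Rabs_pos_eq by (left; apply exp_pos).
        assert (B := Rpower_le_exp t (Re s + 1) Ht ltac:(lra)). rewrite Rpower_plus, Rpower_1 in
            B by assumption.
        rewrite exp_Ropp. assert (Q := exp_pos t).
        apply Rmult_le_reg_r with (exp t * t)%R; [now apply Rmult_lt_0_compat|].
        replace (Rpower t (Re s) * / exp t * (exp t * t))%R with (Rpower t (Re s) * t)%R by
            (field; lra).
        replace (Rpower (Re s + 1) (Re s + 1) / t * (exp t * t))%R with (Rpower (Re s + 1) (Re s
            + 1) * exp t)%R by (field; lra).
        exact B.
      + apply filterlim_div_at_p_infty. left; apply Rpower_pos. }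
  assert (A1 := is_RInt_gen_Cmult s _ (at_right 0) (Rbar_locally p_infty) _ (Gamma_int_is s Hs)).
  assert (A2 := Gamma_int_is (s + 1) ltac:(rewrite Re_plus_R; lra)).
  assert (H2 := is_RInt_gen_minus (V := CV) (Fa := at_right 0) (Fb := Rbar_locally p_infty) _ _ _
      _ A1 A2).
  assert (E := is_RInt_gen_unique_C _ (at_right 0) (Rbar_locally p_infty) _ _ H H2).
  change (0 + - 0 = s * Gamma_int s - Gamma_int (s + 1)) in E.
  symmetry. apply (proj2 (Ceq_minus _ _)). rewrite <- E. ring.
Qed.

Lemma Gamma_int_1 : Gamma_int 1 = 1.
Proof.
  assert (H : is_RInt_gen (V := CV) (gamma_f 1) (at_right 0) (Rbar_locally p_infty) (minus (0 :
      C) (- RtoC 1 : C) : CV)).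
  { apply (is_RInt_gen_derive (V := CV) Dpos Dpos_conv Dpos_at_right Dpos_p_infty (fun t => RtoC
      (- exp (- t)))).
    - intros t Ht. unfold gamma_f. replace (1 - 1)%C with (RtoC 0) by ring. rewrite Rcpow_0,
        Cmult_1_l.
      apply is_derive_RtoC. auto_derive; auto. ring.
    - apply continuous_gamma_f.
    - assert (K : continuous (U := CV) (fun t => RtoC (- exp (- t))) 0%R).
      { eapply continuous_of_derive. apply is_derive_RtoC. auto_derive; auto. }
      unfold continuous in K. rewrite Ropp_0, exp_0, RtoC_opp in K.
      intros P HP. apply filter_le_within. exact (K P HP).
    - apply (filterlim_C_0 (Rbar_locally p_infty) _ (fun t => 1 / t)%R).
      + eapply filter_imp; [|exact Dpos_p_infty]. intros t Ht. unfold Dpos in Ht.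
        rewrite Cmod_R, Rabs_Ropp, Rabs_pos_eq by (left; apply exp_pos).
        rewrite exp_Ropp. unfold Rdiv. rewrite Rmult_1_l. apply Rinv_le_contravar; [exact Ht|].
        pose proof (exp_ineq1_le t). lra.
      + apply filterlim_div_at_p_infty. lra. }
  assert (E := is_RInt_gen_unique_C _ (at_right 0) (Rbar_locally p_infty) _ _ H (Gamma_int_is 1
      ltac:(simpl; lra))).
  rewrite <- E. change (0 + - - (1) = 1). ring.
Qed.

Lemma Gamma_int_S n : Gamma_int (RtoC (INR (S n))) = RtoC (INR (fact n)).
Proof.
  induction n.
  - simpl. apply Gamma_int_1.
  - rewrite RtoC_S, Gamma_int_succ, IHn.
    + rewrite fact_simpl, mult_INR, RtoC_mult. ring.
    + exact (lt_0_INR (S n) ltac:(lia)).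
Qed.

(** The real part of Euler's integral at n + 1; it supplies all the moments used in the
    asymptotics. *)
Lemma is_RInt_gen_pow_exp n :
  is_RInt_gen (fun t => t ^ n * exp (- t))%R (at_right 0) (Rbar_locally p_infty) (INR (fact n)).
Proof.
  assert (H := Gamma_int_is (RtoC (INR (S n))) (lt_0_INR (S n) ltac:(lia))).
  rewrite Gamma_int_S in H.
  assert (H' := is_RInt_gen_linear (U := CV) (V := R_NormedModule) (fun z : CV => fst z) _
      (at_right 0) (Rbar_locally p_infty) _ is_linear_fst H).
  eapply (is_RInt_gen_ext_D Dpos Dpos_conv Dpos_at_right Dpos_p_infty); [|exact H'].
  intros t Ht. unfold gamma_f. rewrite RtoC_S. replace (INR n + 1 - 1)%C with (RtoC (INR n)) by
      ring.
  rewrite Rcpow_INR by exact Ht. rewrite <- RtoC_mult. reflexivity.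
Qed.

(** * Asymptotics of the Gamma integral *)

Lemma Cmod_le_Re_Im (z : C) : (Cmod z <= Rabs (Re z) + Rabs (Im z))%R.
Proof.
  destruct z as [a b]. simpl.
  replace (a, b) with (RtoC a + Ci * RtoC b) by (apply (injective_projections (A := R) (B := R));
      simpl; ring).
  eapply Rle_trans; [apply Cmod_triangle|]. rewrite Cmod_mult, !Cmod_R, Cmod_Ci. lra.
Qed.

Lemma Rabs_sin_le y : (Rabs (sin y) <= Rabs y)%R.
Proof.
  assert (H := bounded_variation sin cos 1 0 y).
  rewrite sin_0, !Rminus_0_r, Rmult_1_l in H. apply H.
  intros t _. split; [apply is_derive_sin | apply Rabs_le, COS_bound].
Qed.

Lemma Rabs_cos_sub_1_le y : (Rabs (cos y - 1) <= Rabs y)%R.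
Proof.
  assert (H := bounded_variation cos (fun t => - sin t)%R 1 0 y).
  rewrite cos_0, !Rminus_0_r, Rmult_1_l in H. apply H.
  intros t _. split; [apply is_derive_cos | rewrite Rabs_Ropp; apply Rabs_le, SIN_bound].
Qed.

Lemma Rabs_exp_sub_1_le x : (Rabs (exp x - 1) <= Rabs x * (1 + exp x))%R.
Proof.
  pose proof (exp_pos x) as Hp. destruct (Rle_dec 0 x) as [H|H].
  - pose proof (exp_ineq1_le (- x)) as K. rewrite exp_Ropp in K.
    assert (1 <= exp x)%R by (pose proof (exp_ineq1_le x); lra).
    rewrite !Rabs_pos_eq by lra.
    apply (Rmult_le_compat_l (exp x)) in K; [|lra]. rewrite Rinv_r in K by lra. nra.
  - pose proof (exp_ineq1_le x) as K.
    assert (exp x < 1)%R by (rewrite <- exp_0; apply exp_increasing; lra).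
    rewrite !Rabs_left by lra. nra.
Qed.

(** With z = x + i y, split e^x cos y - 1 as (e^x - 1) cos y + (cos y - 1), and use the first-order
    bounds for exp, cos and sin. *)
Lemma Cmod_Cexp_sub_1_le z : (Cmod (Cexp z - 1)%C <= (Rabs (Re z) + Rabs (Im z)) * (1 + exp (Re
    z)))%R.
Proof.
  eapply Rle_trans; [apply Cmod_le_Re_Im|].
  destruct z as [x y]. unfold Cexp. simpl.
  replace (exp x * cos y - 0 * sin y + - (1))%R with ((exp x - 1) * cos y + (cos y - 1))%R by
      ring.
  replace (exp x * sin y + 0 * cos y + - 0)%R with (exp x * sin y)%R by ring.
  pose proof (Rabs_triang ((exp x - 1) * cos y) (cos y - 1)) as H1.
  rewrite !Rabs_mult in *. rewrite (Rabs_pos_eq (exp x)) by (left; apply exp_pos).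
  pose proof (Rabs_exp_sub_1_le x). pose proof (Rabs_sin_le y). pose proof (Rabs_cos_sub_1_le y).
  pose proof (exp_pos x). assert (Rabs (cos y) <= 1)%R by apply Rabs_le, COS_bound.
  pose proof (Rabs_pos (exp x - 1)).
  assert (Rabs (exp x - 1) * Rabs (cos y) <= Rabs (exp x - 1) * 1)%R by now apply
      Rmult_le_compat_l.
  assert (exp x * Rabs (sin y) <= exp x * Rabs y)%R by (apply Rmult_le_compat_l; lra). nra.
Qed.

Definition l1norm (s : C) : R := (Rabs (Re s) + Rabs (Im s))%R.

Lemma l1norm_pos s : (0 <= l1norm s)%R.
Proof. unfold l1norm. pose proof (Rabs_pos (Re s)). pose proof (Rabs_pos (Im s)). lra. Qed.

(** The inequality ln w <= w - 1 settles w >= 1; applied to 1/w it settles w < 1. *)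
Lemma Rabs_ln_le w : (0 < w)%R -> (Rabs (ln w) <= Rabs (w - 1) * (1 + / w))%R.
Proof.
  intros Hw. pose proof (Rinv_0_lt_compat w Hw) as Hi.
  pose proof (ln_le_sub_1 w Hw) as H1. pose proof (ln_le_sub_1 (/ w) Hi) as H2. rewrite ln_Rinv
      in H2 by assumption.
  assert (E : ((w - 1) * / w = 1 - / w)%R) by (field; lra).
  destruct (Rle_dec 1 w) as [H|H].
  - assert (0 <= ln w)%R by (rewrite <- ln_1; apply ln_le; lra).
    rewrite !Rabs_pos_eq by lra. nra.
  - assert (ln w < 0)%R by (rewrite <- ln_1; apply ln_increasing; lra).
    rewrite !Rabs_left by lra. nra.
Qed.

(** The bound is linear in |w - 1|, which makes concentration near w = 1 effective. The factor 1 +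
    1/w is later absorbed by one factor w of the weight. *)
Lemma Cmod_Rcpow_sub_1_le w s : (0 < w)%R ->
  (Cmod (Rcpow w s - 1)%C <= l1norm s * (Rabs (w - 1) * (1 + / w)) * (1 + Rpower w (Re s)))%R.
Proof.
  intros Hw. unfold Rcpow. eapply Rle_trans; [apply Cmod_Cexp_sub_1_le|].
  rewrite re_scal_r, im_scal_r, !Rabs_mult.
  unfold Rpower, l1norm. apply Rmult_le_compat_r; [pose proof (exp_pos (Re s * ln w)); lra|].
  rewrite <- Rmult_plus_distr_r. apply Rmult_le_compat_l; [apply l1norm_pos|]. now apply
      Rabs_ln_le.
Qed.

(** Trades a real exponent for an integer one, so that only moments expressible by factorials
    remain. *)
Lemma Rpower_le_1_plus_pow w a m : (0 < w)%R -> (0 <= a <= INR m)%R -> (Rpower w a <= 1 + w ^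
    m)%R.
Proof.
  intros Hw Ha. assert (0 < w ^ m)%R by now apply pow_lt. destruct (Rle_dec 1 w) as [H1|H1].
  - rewrite <- Rpower_pow by assumption. assert (Rpower w a <= Rpower w (INR m))%R by (apply
      Rle_Rpower; lra). lra.
  - assert (Rpower w a <= Rpower 1 a)%R by (apply Rle_Rpower_l; lra). unfold Rpower at 2 in H0.
      rewrite ln_1, Rmult_0_r, exp_0 in H0. lra.
Qed.

Lemma is_RInt_gen_gamma_moment n j : (0 < n)%nat ->
  is_RInt_gen (fun t => t ^ n * exp (- t) * (t / INR n) ^ j)%R (at_right 0) (Rbar_locally p_infty)
    (INR (fact (n + j)) / INR n ^ j)%R.
Proof.
  intros Hn. assert (Hn' : INR n <> 0%R) by (apply not_0_INR; lia).
  assert (Hp : (INR n ^ j <> 0)%R) by now apply pow_nonzero.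
  assert (H := is_RInt_gen_scal (V := R_NormedModule) (Fa := at_right 0) (Fb := Rbar_locally
      p_infty) _ (/ INR n ^ j)%R _ (is_RInt_gen_pow_exp (n + j))).
  replace (INR (fact (n + j)) / INR n ^ j)%R with (scal (/ INR n ^ j)%R (INR (fact (n + j)))) by
      apply Rmult_comm.
  eapply (is_RInt_gen_ext_D Dpos Dpos_conv Dpos_at_right Dpos_p_infty); [|exact H].
  intros t _. change (/ INR n ^ j * (t ^ (n + j) * exp (- t)) = t ^ n * exp (- t) * (t / INR n) ^
      j)%R.
  unfold Rdiv. rewrite pow_add, Rpow_mult_distr, pow_inv. ring.
Qed.

(** Expanding the square combines the moments of orders j, j + 1 and j + 2. The terms in n^2 cancel,
    leaving a second moment about 1 of relative order 1/n. *)
Lemma is_RInt_gen_gamma_variance n j : (0 < n)%nat ->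
  is_RInt_gen (fun t => t ^ n * exp (- t) * (t / INR n) ^ j * (t / INR n - 1) ^ 2)%R (at_right 0)
      (Rbar_locally p_infty)
    (INR (fact (n + j)) / INR n ^ j * ((INR n + INR (S j) * INR (S (S j))) / INR n ^ 2))%R.
Proof.
  intros Hn. assert (Hn' : INR n <> 0%R) by (apply not_0_INR; lia).
  assert (Hp : (INR n ^ j <> 0)%R) by now apply pow_nonzero.
  assert (H0 := is_RInt_gen_gamma_moment n j Hn).
  assert (H1 := is_RInt_gen_scal (V := R_NormedModule) (Fa := at_right 0) (Fb := Rbar_locally
      p_infty) _ (- 2)%R _ (is_RInt_gen_gamma_moment n (S j) Hn)).
  assert (H2 := is_RInt_gen_gamma_moment n (S (S j)) Hn).
  assert (H := is_RInt_gen_plus (V := R_NormedModule) (Fa := at_right 0) (Fb := Rbar_locally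
      p_infty) _ _ _ _ H2
     (is_RInt_gen_plus (V := R_NormedModule) (Fa := at_right 0) (Fb := Rbar_locally p_infty) _ _
         _ _ H1 H0)).
  replace (INR (fact (n + j)) / INR n ^ j * ((INR n + INR (S j) * INR (S (S j))) / INR n ^ 2))%R
      with
    (plus (INR (fact (n + S (S j))) / INR n ^ (S (S j)))%R (plus (scal (-2)%R (INR (fact (n + S
        j)) / INR n ^ (S j))%R) (INR (fact (n + j)) / INR n ^ j)%R)).
  - eapply (is_RInt_gen_ext_D Dpos Dpos_conv Dpos_at_right Dpos_p_infty); [|exact H].
    intros t _. unfold plus, scal; simpl. unfold mult; simpl. ring.
  - unfold plus, scal; simpl plus. change (mult (-2)%R) with (Rmult (-2)). unfold
      AbelianMonoid.plus.
    replace (n + S (S j))%nat with (S (S (n + j))) by lia. replace (n + S j)%nat with (S (n + j))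
        by lia.
    rewrite !fact_simpl, !mult_INR, !S_INR, plus_INR.
    set (F := INR (fact (n + j))). set (N := INR n) in *. set (J := INR j).
    change (N ^ S (S j))%R with (N * (N * N ^ j))%R. change (N ^ S j)%R with (N * N ^ j)%R.
    set (P := (N ^ j)%R) in *.
    change ((N + J + 1 + 1) * ((N + J + 1) * F) / (N * (N * P)) + (-2 * ((N + J + 1) * F / (N *
        P)) + F / P) = F / P * ((N + (J + 1) * (J + 1 + 1)) / N ^ 2))%R.
    field. auto.
Qed.

Lemma fact_add_le n j : (0 < n)%nat ->
  (INR (fact (n + j)) / INR n ^ j <= INR (fact n) * (1 + INR j) ^ j)%R.
Proof.
  intros Hn. assert (Hn' : (0 < INR n)%R) by (apply lt_0_INR; lia).
  (* The base 1 + j is kept fixed while the exponent i grows: every factor (n + i + 1) / n with i <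
     j is at most 1 + j. *)
  assert (H : forall i, (i <= j)%nat -> (INR (fact (n + i)) / INR n ^ i <= INR (fact n) * (1 +
      INR j) ^ i)%R).
  { induction i; intros Hi.
    - rewrite Nat.add_0_r. simpl. lra.
    - specialize (IHi ltac:(lia)). rewrite Nat.add_succ_r, fact_simpl, mult_INR.
      replace (INR (S (n + i)) * INR (fact (n + i)) / INR n ^ S i)%R with
        ((INR (fact (n + i)) / INR n ^ i) * (INR (S (n + i)) / INR n))%R.
      2:{ simpl pow. field. split; [apply pow_nonzero|]; lra. }
      replace (INR (fact n) * (1 + INR j) ^ S i)%R with ((INR (fact n) * (1 + INR j) ^ i) * (1 +
          INR j))%R by (simpl; ring).
      apply Rmult_le_compat; try assumption.
      + apply Rmult_le_pos; [apply pos_INR|]. left. apply Rinv_0_lt_compat. now apply pow_lt.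
      + apply Rmult_le_pos; [apply pos_INR|]. left. now apply Rinv_0_lt_compat.
      + apply Rmult_le_reg_r with (INR n); [assumption|]. unfold Rdiv. rewrite Rmult_assoc,
          Rinv_l, Rmult_1_r by lra.
        rewrite S_INR, plus_INR. assert (1 <= INR n)%R by (apply (le_INR 1); lia).
        apply le_INR in Hi. rewrite S_INR in Hi. pose proof (pos_INR i). nra. }
  apply H. lia.
Qed.

(** The first factor is the growth bound of [fact_add_le]. In the second, with c = (j + 1)(j + 2),
    one 1 is the plain moment and 1 + c/n <= 1 + c comes from n times the relative second moment
    about 1. *)
Definition moment_const (j : nat) : R := ((1 + INR j) ^ j * (2 + INR (S j) * INR (S (S j))))%R.

(* The last factor bounds [2 |w - 1|], [w = t / n], by AM-GM. *)
Lemma gamma_abs_moment n j : (0 < n)%nat -> exists v,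
  (v <= INR (fact n) * moment_const j / sqrt (INR n))%R /\ is_RInt_gen (fun t => t ^ n * exp (-
      t) * (t / INR n) ^ j * (/ sqrt (INR n) + sqrt (INR n) * (t / INR n - 1) ^ 2))%R
   (at_right 0) (Rbar_locally p_infty) v.
Proof.
  intros Hn. assert (Hn' : (1 <= INR n)%R) by (apply (le_INR 1); lia).
  set (r := sqrt (INR n)). assert (Hr : (0 < r)%R) by (apply sqrt_lt_R0; lra).
  assert (Hrr : (r * r = INR n)%R) by (apply sqrt_sqrt; lra).
  assert (H0 := is_RInt_gen_scal (V := R_NormedModule) (Fa := at_right 0) (Fb := Rbar_locally
      p_infty) _ (/ r)%R _ (is_RInt_gen_gamma_moment n j Hn)).
  assert (H1 := is_RInt_gen_scal (V := R_NormedModule) (Fa := at_right 0) (Fb := Rbar_locally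
      p_infty) _ r _ (is_RInt_gen_gamma_variance n j Hn)).
  assert (H := is_RInt_gen_plus (V := R_NormedModule) (Fa := at_right 0) (Fb := Rbar_locally
      p_infty) _ _ _ _ H0 H1).
  eexists. split; [|eapply (is_RInt_gen_ext_D Dpos Dpos_conv Dpos_at_right Dpos_p_infty); [|exact
      H]].
  - assert (B := fact_add_le n j Hn). set (A := (INR (fact (n + j)) / INR n ^ j)%R) in *.
    change (/ r * A + r * (A * ((INR n + INR (S j) * INR (S (S j))) / INR n ^ 2)) <= INR (fact n)
        * moment_const j / r)%R.
    set (c := (INR (S j) * INR (S (S j)))%R).
    assert (Hc : (0 <= c)%R) by (apply Rmult_le_pos; apply pos_INR).
    replace (r * (A * ((INR n + c) / INR n ^ 2)))%R with (/ r * A * ((INR n + c) / INR n))%R by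
        (rewrite <- Hrr; field; lra).
    unfold moment_const. fold c.
    replace (/ r * A + / r * A * ((INR n + c) / INR n))%R with (/ r * (A * (2 + c / INR n)))%R by
        (field; lra).
    replace (INR (fact n) * ((1 + INR j) ^ j * (2 + c)) / r)%R with (/ r * ((INR (fact n) * (1 +
        INR j) ^ j) * (2 + c)))%R by (field; lra).
    apply Rmult_le_compat_l; [left; now apply Rinv_0_lt_compat|].
    assert (c / INR n <= c)%R.
    { apply Rmult_le_reg_r with (INR n); [lra|]. unfold Rdiv. rewrite Rmult_assoc, Rinv_l,
        Rmult_1_r by lra. nra. }
    assert (0 <= c / INR n)%R by (apply Rmult_le_pos; [lra | left; apply Rinv_0_lt_compat; lra]).
    apply Rmult_le_compat; try lra.
    apply Rmult_le_pos; [apply pos_INR|]. left. apply Rinv_0_lt_compat. apply pow_lt. lra.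
  - intros t _. unfold plus, scal; simpl. unfold mult; simpl. ring.
Qed.

(** Makes |w - 1| polynomial, so that exact moments apply. The choice r = sqrt n balances the two
    terms, as the second moment about 1 is of order 1/n. *)
Lemma AM_GM_abs x r : (0 < r)%R -> (Rabs x <= (/ r + r * x ^ 2) / 2)%R.
Proof.
  intros Hr. assert (E : (/ r + r * x ^ 2 - 2 * Rabs x = / r * (r * Rabs x - 1) ^ 2)%R).
  { rewrite <- (pow2_abs x). field. lra. }
  assert (0 <= / r * (r * Rabs x - 1) ^ 2)%R by (apply Rmult_le_pos; [left; now apply
      Rinv_0_lt_compat | apply pow2_ge_0]).
  lra.
Qed.

(** With N = n and t = N w, the difference is N^s t^(n+1) e^(-t) (w^s - 1). One factor t = N w turns
    1 + 1/w into w + 1. The right side is arranged so that its two terms are the integrands of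
    [gamma_abs_moment] for j = 0 and j = m + 1. *)
Lemma gamma_f_diff_le s m n t : (0 < n)%nat -> (0 < t)%R -> (0 <= Re s <= INR m)%R ->
  (Cmod (gamma_f (s + RtoC (INR (S (S n)))) t - Rcpow (INR n) s * gamma_f (RtoC (INR (S (S n))))
      t)%C <=
   Rpower (INR n) (Re s) * (3 * l1norm s * INR n) *
   (t ^ n * exp (- t) * (t / INR n) ^ 0 * (/ sqrt (INR n) + sqrt (INR n) * (t / INR n - 1) ^ 2) +
    t ^ n * exp (- t) * (t / INR n) ^ (S m) * (/ sqrt (INR n) + sqrt (INR n) * (t / INR n - 1) ^
        2)))%R.
Proof.
  intros Hn Ht Hs. assert (HN : (0 < INR n)%R) by (apply lt_0_INR; lia).
  set (N := INR n) in *. set (w := (t / N)%R).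
  assert (Hw : (0 < w)%R) by now apply Rdiv_lt_0_compat.
  assert (Et : t = (N * w)%R) by (unfold w; field; lra).
  assert (E : gamma_f (s + RtoC (INR (S (S n)))) t - Rcpow N s * gamma_f (RtoC (INR (S (S n)))) t
      =
     Rcpow N s * (RtoC (t ^ S n * exp (- t))%R * (Rcpow w s - 1))).
  { unfold gamma_f. rewrite (RtoC_S (S n)).
    replace (s + (INR (S n) + 1) - 1)%C with (s + INR (S n)) by ring.
    replace (INR (S n) + 1 - 1)%C with (RtoC (INR (S n))) by ring.
    rewrite Rcpow_plus, !(Rcpow_INR t) by assumption. rewrite Et at 1. rewrite Rcpow_mult by
        assumption. rewrite RtoC_mult. ring. }
  rewrite E, !Cmod_mult, Cmod_Rcpow, Cmod_R. clear E.
  rewrite !Rmult_assoc. apply Rmult_le_compat_l; [left; apply Rpower_pos|].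
  set (X := exp (- t)). assert (HX : (0 < X)%R) by apply exp_pos.
  rewrite Rabs_pos_eq by (apply Rmult_le_pos; [apply pow_le; lra | lra]).
  set (q := (/ sqrt N + sqrt N * (w - 1) ^ 2)%R).
  assert (Hq : (Rabs (w - 1) <= q / 2)%R) by (apply AM_GM_abs, sqrt_lt_R0; lra).
  assert (B1 := Cmod_Rcpow_sub_1_le w s Hw).
  assert (B2 := Rpower_le_1_plus_pow w (Re s) m Hw Hs).
  assert (HL := l1norm_pos s). set (L := l1norm s) in *.
  assert (Hwm : (0 < w ^ m)%R) by now apply pow_lt.
  (* The 6 comes from (w + 1)(2 + w^m): at most 6 w^(m+1) if w >= 1 and at most 6 otherwise. Halved
     by q / 2, it becomes the 3 of the statement. *)
  assert (B3 : (w * Cmod (Rcpow w s - 1)%C <= L * (q / 2) * (6 * (1 + w ^ S m)))%R).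
  { apply Rle_trans with (L * Rabs (w - 1) * ((w + 1) * (2 + w ^ m)))%R.
    - apply Rle_trans with (w * (L * (Rabs (w - 1) * (1 + / w)) * (1 + Rpower w (Re s))))%R.
      + apply Rmult_le_compat_l; lra.
      + replace (w * (L * (Rabs (w - 1) * (1 + / w)) * (1 + Rpower w (Re s))))%R with
         (L * Rabs (w - 1) * ((w + 1) * (1 + Rpower w (Re s))))%R by (field; lra).
        apply Rmult_le_compat_l; [apply Rmult_le_pos; [lra | apply Rabs_pos]|].
        apply Rmult_le_compat_l; lra.
    - apply Rmult_le_compat; [apply Rmult_le_pos; [lra | apply Rabs_pos] | apply Rmult_le_pos;
        lra | apply Rmult_le_compat_l; lra |].
      simpl pow. destruct (Rle_dec 1 w) as [H|H].
      + assert (1 <= w ^ m)%R by now apply pow_R1_Rle. nra.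
      + assert (w ^ m <= 1)%R. { rewrite <- (pow1 m). apply pow_incr. lra. } nra. }
  replace (t ^ S n)%R with (N * w * t ^ n)%R by (simpl; rewrite <- Et; reflexivity).
  assert (0 < t ^ n)%R by now apply pow_lt.
  replace (N * w * t ^ n * X * Cmod (Rcpow w s - 1)%C)%R with (N * (t ^ n * X) * (w * Cmod (Rcpow
      w s - 1)%C))%R by ring.
  apply Rle_trans with (N * (t ^ n * X) * (L * (q / 2) * (6 * (1 + w ^ S m))))%R.
  - apply Rmult_le_compat_l; [|exact B3]. repeat (apply Rmult_le_pos); lra.
  - right. rewrite pow_O. field.
Qed.

Lemma Gamma_int_asymp s : (0 <= Re s)%R -> exists K, forall n, (0 < n)%nat ->
  (Cmod (Gamma_int (s + RtoC (INR (S (S n)))) - Rcpow (INR n) s * RtoC (INR (fact (S n))))%C <=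
   K / sqrt (INR n) * (INR n * INR (fact n) * Rpower (INR n) (Re s)))%R.
Proof.
  intros Hs.
  destruct (INR_unbounded (Re s)) as [m Hm].
  exists (3 * l1norm s * (moment_const 0 + moment_const (S m)))%R. intros n Hn.
  destruct (gamma_abs_moment n 0 Hn) as (v0 & B0 & I0).
  destruct (gamma_abs_moment n (S m) Hn) as (v1 & B1 & I1).
  assert (HN : (0 < INR n)%R) by (apply lt_0_INR; lia).
  assert (HS : (0 < INR (S (S n)))%R) by (apply lt_0_INR; lia).
  assert (G1 := Gamma_int_is (s + RtoC (INR (S (S n)))) ltac:(rewrite Re_plus_R; lra)).
  assert (G2 := is_RInt_gen_Cmult (Rcpow (INR n) s) _ (at_right 0) (Rbar_locally p_infty) _
      (Gamma_int_is (RtoC (INR (S (S n)))) HS)).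
  assert (G := is_RInt_gen_minus (V := CV) (Fa := at_right 0) (Fb := Rbar_locally p_infty) _ _ _
      _ G1 G2).
  rewrite Gamma_int_S in G.
  assert (R := is_RInt_gen_scal (V := R_NormedModule) (Fa := at_right 0) (Fb := Rbar_locally
      p_infty) _ (Rpower (INR n) (Re s) * (3 * l1norm s * INR n))%R _
    (is_RInt_gen_plus (V := R_NormedModule) (Fa := at_right 0) (Fb := Rbar_locally p_infty) _ _ _
        _ I0 I1)).
  assert (Q := RInt_gen_norm_D (V := CV) Dpos Dpos_conv Dpos_at_right Dpos_p_infty Dpos_le _ _ _ _
    (fun t Ht => eq_ind_r (fun r => (r <= _)%R) (gamma_f_diff_le s m n t Hn Ht (conj Hs (Rlt_le _
        _ Hm))) (norm_C _)) G R).
  rewrite norm_C in Q.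
  change (Cmod (Gamma_int (s + RtoC (INR (S (S n)))) - Rcpow (INR n) s * RtoC (INR (fact (S
      n))))%C <=
    Rpower (INR n) (Re s) * (3 * l1norm s * INR n) * (v0 + v1))%R in Q.
  eapply Rle_trans; [exact Q|].
  apply Rle_trans with (Rpower (INR n) (Re s) * (3 * l1norm s * INR n) *
    (INR (fact n) * moment_const 0 / sqrt (INR n) + INR (fact n) * moment_const (S m) / sqrt (INR
        n)))%R.
  - apply Rmult_le_compat_l; [|lra]. pose proof (l1norm_pos s). pose proof (Rpower_pos (INR n)
      (Re s)).
    repeat apply Rmult_le_pos; lra.
  - right. field. apply Rgt_not_eq, sqrt_lt_R0, HN.
Qed.

(** * Constancy of the Beta-Gamma quotient *)

Lemma C_neq_0_of_Re (z : C) : (Re z <> 0)%R -> z <> 0.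
Proof. intros H E. apply H. now rewrite E. Qed.

Lemma Gamma_int_zero_add s n : (0 < Re s)%R -> Gamma_int s = 0 -> Gamma_int (s + RtoC (INR n)) =
    0.
Proof.
  intros Hs H. induction n.
  - simpl. now rewrite Cplus_0_r.
  - rewrite RtoC_S, Cplus_assoc, Gamma_int_succ, IHn; [ring|].
    rewrite Re_plus_R. pose proof (pos_INR n). lra.
Qed.

(** A zero would propagate to every s + n by the functional equation. In the asymptotic estimate the
    main term alone would then be bounded by an error smaller by the order of sqrt n. *)
Lemma Gamma_int_neq_0 s : (0 < Re s)%R -> Gamma_int s <> 0.
Proof.
  intros Hs H. destruct (Gamma_int_asymp s (Rlt_le _ _ Hs)) as [K HK].
  destruct (INR_unbounded (K * K)) as [n Hn].
  specialize (HK (S n) ltac:(lia)). rewrite Gamma_int_zero_add in HK by assumption.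
  assert (HN : (1 <= INR (S n))%R) by (apply (le_INR 1); lia).
  assert (Hn' : (K * K < INR (S n))%R) by (rewrite S_INR; lra).
  set (N := INR (S n)) in *.
  replace (0 - Rcpow N s * RtoC (INR (fact (S (S n)))))%C with (- (Rcpow N s * RtoC (INR (fact (S
      (S n))))))%C in HK by ring.
  rewrite Cmod_opp, Cmod_mult, Cmod_Rcpow, Cmod_R, Rabs_pos_eq in HK by apply pos_INR.
  rewrite (fact_simpl (S n)), mult_INR, (S_INR (S n)) in HK. fold N in HK.
  assert (Hr : (0 < sqrt N)%R) by (apply sqrt_lt_R0; lra).
  assert (Hrr : (sqrt N * sqrt N = N)%R) by (apply sqrt_sqrt; lra).
  set (r := sqrt N) in *.
  assert (HP : (0 < Rpower N (Re s) * INR (fact (S n)))%R) by (apply Rmult_lt_0_compat; [apply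
      Rpower_pos | apply INR_fact_lt_0]).
  replace (Rpower N (Re s) * ((N + 1) * INR (fact (S n))))%R with ((N + 1) * (Rpower N (Re s) *
      INR (fact (S n))))%R in HK by ring.
  replace (K / r * (N * INR (fact (S n)) * Rpower N (Re s)))%R with ((K / r * N) * (Rpower N (Re
      s) * INR (fact (S n))))%R in HK by ring.
  apply Rmult_le_reg_r in HK; [|exact HP].
  replace (K / r * N)%R with (K * r)%R in HK by (rewrite <- Hrr; field; lra).
  (* What remains is N + 1 <= K r, while K < r and r^2 = N. *)
  assert (K < r)%R by nra. nra.
Qed.

(** Convergence is phrased through a real null sequence, so that the squeeze lemmas for real
    sequences apply directly. *)
Definition Ccv (u : nat -> C) (l : C) : Prop := is_lim_seq (fun n => Cmod (u n - l)%C) 0%R.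

Lemma is_lim_seq_0_le (u v : nat -> R) : eventually (fun n => 0 <= u n <= v n)%R ->
  is_lim_seq v 0%R -> is_lim_seq u 0%R.
Proof.
  intros H Hv. apply (is_lim_seq_le_le_loc (fun _ => 0%R) u v); auto. apply is_lim_seq_const.
Qed.

Lemma is_lim_seq_lin_0 (u v : nat -> R) (a b : R) : is_lim_seq u 0%R -> is_lim_seq v 0%R ->
  is_lim_seq (fun n => a * u n + b * v n)%R 0%R.
Proof.
  intros Hu Hv. replace (Finite 0) with (Finite (a * 0 + b * 0)) by (f_equal; ring).
  apply is_lim_seq_plus'.
  - apply (is_lim_seq_scal_l u a 0%R Hu).
  - apply (is_lim_seq_scal_l v b 0%R Hv).
Qed.

Lemma is_lim_seq_0_lt (u : nat -> R) (e : R) : is_lim_seq u 0%R -> (0 < e)%R -> eventually (fun n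
    => u n < e)%R.
Proof.
  intros H He. destruct (proj2 (is_lim_seq_spec _ _) H (mkposreal e He)) as [N HN].
  exists N. intros n Hn. specialize (HN n Hn). simpl in HN. apply Rabs_def2 in HN. lra.
Qed.

Lemma Ccv_unique u l m : Ccv u l -> Ccv u m -> l = m.
Proof.
  intros Hl Hm. apply Ceq_minus, Cmod_eq_0.
  apply Rle_antisym; [|apply Cmod_ge_0].
  assert (H := is_lim_seq_lin_0 _ _ 1 1 Hl Hm).
  apply (is_lim_seq_le (fun _ => Cmod (l - m)%C) _ (Cmod (l - m)%C) 0%R) in H; [exact H| |apply
      is_lim_seq_const].
  intros n. rewrite !Rmult_1_l. replace (l - m)%C with (- (u n - l) + (u n - m))%C by ring.
  eapply Rle_trans; [apply Cmod_triangle|]. rewrite Cmod_opp. lra.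
Qed.

Lemma Ccv_const_mult (c : C) u l : Ccv u l -> Ccv (fun n => c * u n) (c * l).
Proof.
  intros H. unfold Ccv. apply (is_lim_seq_ext (fun n => Cmod c * Cmod (u n - l)%C + 0 * Cmod (u n
      - l)%C)%R).
  - intros n. rewrite Rmult_0_l, Rplus_0_r, <- Cmod_mult. f_equal. ring.
  - now apply is_lim_seq_lin_0.
Qed.

Lemma Ccv_div u v : Ccv u 1 -> Ccv v 1 -> Ccv (fun n => u n / v n) 1.
Proof.
  intros Hu Hv. unfold Ccv.
  apply (is_lim_seq_0_le _ (fun n => 2 * Cmod (u n - 1)%C + 2 * Cmod (v n - 1)%C)%R); [|now apply
      is_lim_seq_lin_0].
  destruct (is_lim_seq_0_lt _ (1 / 2) Hv ltac:(lra)) as [N HN]. exists N. intros n Hn. specialize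
      (HN n Hn).
  split; [apply Cmod_ge_0|].
  assert (H1 : (1 / 2 <= Cmod (v n))%R).
  { assert (T := Cmod_triangle (v n) (- (v n - 1))). rewrite Cmod_opp in T.
    replace (v n + - (v n - 1))%C with (RtoC 1) in T by ring. rewrite Cmod_1 in T. lra. }
  assert (H2 : v n <> 0) by (apply Cmod_gt_0; lra).
  replace (u n / v n - 1)%C with ((u n - v n) / v n)%C by (field; auto).
  rewrite Cmod_div by assumption.
  assert (T := Cmod_triangle (u n - 1) (- (v n - 1))). rewrite Cmod_opp in T.
  replace (u n - 1 + - (v n - 1))%C with (u n - v n)%C in T by ring.
  apply Rmult_le_reg_r with (Cmod (v n)); [lra|]. unfold Rdiv. rewrite Rmult_assoc, Rinv_l,
      Rmult_1_r by lra.
  pose proof (Cmod_ge_0 (u n - 1)). pose proof (Cmod_ge_0 (v n - 1)). nra.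
Qed.

Lemma is_lim_seq_inv_INR : is_lim_seq (fun n => / INR n)%R 0%R.
Proof.
  replace (Finite 0) with (Rbar_inv p_infty) by reflexivity.
  apply is_lim_seq_inv; [apply is_lim_seq_INR | discriminate].
Qed.

Lemma is_lim_seq_inv_sqrt_INR : is_lim_seq (fun n => / sqrt (INR n))%R 0%R.
Proof.
  replace (Finite 0) with (Rbar_inv p_infty) by reflexivity.
  apply is_lim_seq_inv; [|discriminate].
  apply is_lim_seq_p_infty_Reals. intros M.
  destruct (INR_unbounded (M * M)) as [N HN]. exists N. intros n Hn. apply le_INR in Hn.
  destruct (Rle_dec 0 M) as [HM|HM].
  - rewrite <- (sqrt_square M) by assumption. apply sqrt_lt_1; nra.
  - pose proof (sqrt_pos (INR n)). lra.
Qed.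

Definition gamma_ratio (s : C) (n : nat) : C :=
  Gamma_int (s + RtoC (INR (S (S n)))) / (RtoC (INR n * INR (fact n)) * Rcpow (INR n) s).

Lemma gamma_ratio_cv s : (0 <= Re s)%R -> Ccv (gamma_ratio s) 1.
Proof.
  intros Hs. destruct (Gamma_int_asymp s Hs) as [K HK]. unfold Ccv.
  apply (is_lim_seq_0_le _ (fun n => K * / sqrt (INR n) + 1 * / INR n)%R);
    [|apply is_lim_seq_lin_0; [apply is_lim_seq_inv_sqrt_INR | apply is_lim_seq_inv_INR]].
  exists 1%nat. intros n Hn. split; [apply Cmod_ge_0|]. specialize (HK n Hn).
  assert (HN : (0 < INR n)%R) by (apply lt_0_INR; lia).
  assert (HF : (0 < INR (fact n))%R) by apply INR_fact_lt_0.
  set (d := RtoC (INR n * INR (fact n)) * Rcpow (INR n) s).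
  assert (Hd : d <> 0).
  { apply Cmult_neq_0; [|apply Rcpow_neq_0]. apply C_neq_0_of_Re. simpl. nra. }
  assert (Md : Cmod d = (INR n * INR (fact n) * Rpower (INR n) (Re s))%R).
  { unfold d. rewrite Cmod_mult, Cmod_Rcpow, Cmod_R, Rabs_pos_eq by nra. reflexivity. }
  assert (Pd : (0 < Cmod d)%R) by now apply Cmod_gt_0.
  rewrite <- Md in HK.
  unfold gamma_ratio. fold d.
  (* The term 1/n is the price of normalising by n n! instead of (n + 1)!. *)
  replace (Gamma_int (s + RtoC (INR (S (S n)))) / d - 1)%C with
    ((Gamma_int (s + RtoC (INR (S (S n)))) - Rcpow (INR n) s * RtoC (INR (fact (S n)))) / d +
        RtoC (/ INR n))%C.
  - eapply Rle_trans; [apply Cmod_triangle|]. rewrite Cmod_div, Cmod_R by assumption.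
    rewrite (Rabs_pos_eq (/ INR n)) by (left; now apply Rinv_0_lt_compat). rewrite Rmult_1_l.
    apply Rplus_le_compat_r. apply Rmult_le_reg_r with (Cmod d); [exact Pd|].
    unfold Rdiv. rewrite (Rmult_assoc _ (/ Cmod d)), Rinv_l, Rmult_1_r by lra. exact HK.
  - rewrite (fact_simpl n), mult_INR, (RtoC_mult (INR (S n))), (RtoC_S n), RtoC_inv by lra.
      unfold d.
    rewrite RtoC_mult.
    assert (RtoC (INR n) <> 0) by (apply C_neq_0_of_Re; simpl; lra).
    pose proof (INR_fact_neq_0_C n). pose proof (Rcpow_neq_0 (INR n) s). field. auto.
Qed.

(** With w = 1 - x^2, the difference is w^(n+1) (w^s - 1). One factor w absorbs 1/w, the factor |w -
    1| is exactly x^2 and produces the integrand of I_1(n + 1), and 4 bounds (w + 1)(1 + w^(Re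
    s)). *)
Lemma beta_f_diff_le s n x : (0 <= Re s)%R -> Dseg 1 x ->
  (Cmod (beta_f 1 0 (s + RtoC (INR (S (S n)))) x - beta_f 1 0 (RtoC (INR (S (S n)))) x)%C <=
    4 * l1norm s * Re (beta_f 1 1 (RtoC (INR (S n))) x))%R.
Proof.
  intros Hs Hx. assert (Hw := sq_sub_pos 1 x Hx). unfold beta_f.
  rewrite (RtoC_S (S n)), (RtoC_S n).
  replace (s + (INR n + 1 + 1) - 1)%C with (s + RtoC (INR n) + 1)%C by ring.
  replace (INR n + 1 + 1 - 1)%C with (RtoC (INR n) + 1)%C by ring.
  replace (INR n + 1 - 1)%C with (RtoC (INR n)) by ring.
  set (w := (1 ^ 2 - x ^ 2)%R) in *. change (2 * 0)%nat with 0%nat. change (2 * 1)%nat with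
      2%nat. rewrite !pow_O.
  rewrite !Rcpow_plus_1, Rcpow_plus, Rcpow_INR by exact Hw.
  replace (RtoC 1 * (Rcpow w s * RtoC (w ^ n) * RtoC w) - RtoC 1 * (RtoC (w ^ n) * RtoC w))%C
      with (RtoC (w ^ n * w) * (Rcpow w s - 1))%C by (rewrite RtoC_mult; ring).
  assert (Hwn : (0 < w ^ n)%R) by now apply pow_lt.
  rewrite Cmod_mult, Cmod_R, Rabs_pos_eq by nra. rewrite <- RtoC_mult, re_RtoC.
  assert (B := Cmod_Rcpow_sub_1_le w s Hw).
  assert (Hw1 : (w <= 1)%R) by (unfold w; nra).
  assert (Rpower w (Re s) <= 1)%R.
  { assert (Rpower w (Re s) <= Rpower 1 (Re s))%R by (apply Rle_Rpower_l; lra).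
    unfold Rpower at 2 in H. rewrite ln_1, Rmult_0_r, exp_0 in H. lra. }
  assert (HL := l1norm_pos s). set (L := l1norm s) in *.
  replace (Rabs (w - 1)) with (x ^ 2)%R in B.
  2:{ rewrite Rabs_left1 by lra. unfold w. ring. }
  assert (Hx2 : (0 <= x ^ 2)%R) by apply pow2_ge_0.
  replace (w ^ n * w * Cmod (Rcpow w s - 1)%C)%R with (w ^ n * (w * Cmod (Rcpow w s - 1)%C))%R by
      ring.
  replace (4 * L * (x ^ 2 * w ^ n))%R with (w ^ n * (4 * L * x ^ 2))%R by ring.
  apply Rmult_le_compat_l; [lra|].
  apply Rle_trans with (w * (L * (x ^ 2 * (1 + / w)) * (1 + Rpower w (Re s))))%R; [apply
      Rmult_le_compat_l; lra|].
  replace (w * (L * (x ^ 2 * (1 + / w)) * (1 + Rpower w (Re s))))%R with ((L * x ^ 2) * ((w + 1)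
      * (1 + Rpower w (Re s))))%R by (field; lra).
  replace (4 * L * x ^ 2)%R with ((L * x ^ 2) * (2 * 2))%R by ring.
  pose proof (Rpower_pos w (Re s)).
  apply Rmult_le_compat_l; [now apply Rmult_le_pos|]. apply Rmult_le_compat; lra.
Qed.

(** Integration by parts gives I_0(n + 2) = 2 (n + 1) I_1(n + 1), so the integrated bound is small
    relative to I_0(n + 2) itself. *)
Lemma beta_int_diff_le s n : (0 <= Re s)%R ->
  (Cmod (beta_int 0 (s + RtoC (INR (S (S n)))) - beta_int 0 (RtoC (INR (S (S n)))))%C <= 2 *
      l1norm s / INR (S n) * Cmod (beta_int 0 (RtoC (INR (S (S n))))))%R.
Proof.
  intros Hs.
  assert (HS : (0 < INR (S n))%R) by (apply lt_0_INR; lia).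
  assert (HSS : (0 < INR (S (S n)))%R) by (apply lt_0_INR; lia).
  assert (G1 := beta_int_is 0 (s + RtoC (INR (S (S n)))) ltac:(rewrite Re_plus_R; lra)).
  assert (G2 := beta_int_is 0 (RtoC (INR (S (S n)))) HSS).
  assert (G := is_RInt_gen_minus (V := CV) (Fa := at_point 0) (Fb := at_left 1) _ _ _ _ G1 G2).
  assert (R0 := is_RInt_gen_linear (U := CV) (V := R_NormedModule) (fun z : CV => fst z) _
      (at_point 0) (at_left 1) _ is_linear_fst (beta_int_is 1 (RtoC (INR (S n))) HS)).
  assert (R := is_RInt_gen_scal (V := R_NormedModule) (Fa := at_point 0) (Fb := at_left 1) _ (4 *
      l1norm s)%R _ R0).
  assert (Q := RInt_gen_norm_D (V := CV) (Dseg 1) (Dseg_conv 1) (Dseg_at_point 1 Rlt_0_1)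
      (Dseg_at_left 1 Rlt_0_1) (Dseg_le 1 Rlt_0_1) _ _ _ _
    (fun x Hx => eq_ind_r (fun r => (r <= _)%R) (beta_f_diff_le s n x Hs Hx) (norm_C _)) G R).
  rewrite norm_C in Q.
  change (Cmod (beta_int 0 (s + RtoC (INR (S (S n)))) - beta_int 0 (RtoC (INR (S (S n)))))%C <=
    4 * l1norm s * Re (beta_int 1 (RtoC (INR (S n)))))%R in Q.
  eapply Rle_trans; [exact Q|].
  assert (P := beta_int_parts 0 (RtoC (INR (S n))) HS). rewrite <- RtoC_S in P. simpl (INR (2 * 0
      + 1)) in P. rewrite Cmult_1_l in P.
  rewrite P, !Cmod_mult, !Cmod_R, !Rabs_pos_eq by lra.
  replace (2 * l1norm s / INR (S n) * (2 * INR (S n) * Cmod (beta_int 1 (INR (S n)))))%R with (4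
      * l1norm s * Cmod (beta_int 1 (INR (S n))))%R by (field; lra).
  apply Rmult_le_compat_l; [pose proof (l1norm_pos s); lra|].
  eapply Rle_trans; [apply Rle_abs | apply re_le_Cmod].
Qed.

(** The function [F] of the overview; its constant value is Gamma(1/2) / 2. *)
Definition beta_quot (s : C) : C := beta_int 0 s * Gamma_int (s + RtoC (1 / 2)) / Gamma_int s.

(** Eliminates I_1(s) between the shift and the integration by parts. The factors s and s + 1/2 are
    those produced by the two Gamma functions in [beta_quot]. *)
Lemma beta_int_0_succ s : (0 < Re s)%R -> s * beta_int 0 s = (s + RtoC (1 / 2)) * beta_int 0 (s +
    1).
Proof.
  intros Hs. assert (H1 := beta_int_shift 0 s Hs). assert (H2 := beta_int_parts 0 s Hs).
  simpl (INR (2 * 0 + 1)) in H2. rewrite Cmult_1_l in H2.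
  replace (beta_int 0 s) with (beta_int 0 (s + 1) + beta_int 1 s) by (rewrite H1; ring).
  replace (RtoC (1 / 2)) with (/ 2)%C by (rewrite RtoC_div by lra; field; apply C_neq_0_of_Re;
      simpl; lra).
  replace ((s + / 2) * beta_int 0 (s + 1)) with (s * beta_int 0 (s + 1) + / 2 * beta_int 0 (s +
      1)) by ring.
  rewrite H2 at 3. field.
Qed.

Lemma beta_quot_succ s : (0 < Re s)%R -> beta_quot (s + 1) = beta_quot s.
Proof.
  intros Hs. unfold beta_quot.
  assert (N1 : s <> 0) by (apply C_neq_0_of_Re; lra).
  assert (N2 := Gamma_int_neq_0 s Hs).
  replace (s + 1 + RtoC (1 / 2)) with (s + RtoC (1 / 2) + 1) by ring.
  rewrite !Gamma_int_succ by (rewrite ?Re_plus_R; lra).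
  replace (beta_int 0 (s + 1) * ((s + RtoC (1 / 2)) * Gamma_int (s + RtoC (1 / 2))) / (s *
      Gamma_int s)) with
   (((s + RtoC (1 / 2)) * beta_int 0 (s + 1)) * Gamma_int (s + RtoC (1 / 2)) / (s * Gamma_int s))
       by (field; auto).
  rewrite <- beta_int_0_succ by assumption. field. auto.
Qed.

Lemma beta_quot_add s n : (0 < Re s)%R -> beta_quot (s + RtoC (INR n)) = beta_quot s.
Proof.
  intros Hs. induction n.
  - simpl. now rewrite Cplus_0_r.
  - rewrite RtoC_S, Cplus_assoc, beta_quot_succ, IHn; [reflexivity|].
    rewrite Re_plus_R. pose proof (pos_INR n). lra.
Qed.

Lemma beta_quot_lim s : (0 < Re s)%R ->
  Ccv (fun n => RtoC (sqrt (INR n)) * beta_int 0 (RtoC (INR (S (S n))))) (beta_quot s).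
Proof.
  intros Hs.
  set (c := fun n => RtoC (sqrt (INR n)) * beta_int 0 (s + RtoC (INR (S (S n))))).
  set (b := fun n => RtoC (sqrt (INR n)) * beta_int 0 (RtoC (INR (S (S n))))).
  (* By periodicity, [c n] is F(s) times the quotient of the normalised Gammas at s and s + 1/2; the
     factor sqrt n is n^(s + 1/2) / n^s. *)
  assert (Hc : Ccv c (beta_quot s)).
  { replace (beta_quot s) with (beta_quot s * 1) at 1 by ring.
    assert (K := Ccv_const_mult (beta_quot s) _ _ (Ccv_div _ _ (gamma_ratio_cv s ltac:(lra))
        (gamma_ratio_cv (s + RtoC (1 / 2)) ltac:(rewrite Re_plus_R; lra)))).
    unfold Ccv in *. eapply is_lim_seq_ext_loc; [|exact K].
    exists 1%nat. intros n Hn. cbv beta. f_equal. f_equal.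
    rewrite <- (beta_quot_add s (S (S n)) Hs). unfold beta_quot, gamma_ratio, c.
    assert (HN : (0 < INR n)%R) by (apply lt_0_INR; lia).
    pose proof (pos_INR (S (S n))).
    assert (N1 := Gamma_int_neq_0 (s + RtoC (INR (S (S n)))) ltac:(rewrite !Re_plus_R; lra)).
    assert (N2 := Gamma_int_neq_0 (s + RtoC (1 / 2) + RtoC (INR (S (S n)))) ltac:(rewrite
        !Re_plus_R; lra)).
    replace (s + RtoC (INR (S (S n))) + RtoC (1 / 2)) with (s + RtoC (1 / 2) + RtoC (INR (S (S
        n)))) by ring.
    rewrite Rcpow_plus, (Rcpow_RtoC _ (1 / 2)). replace (1 / 2)%R with (/ 2)%R at 3 by field.
        rewrite Rpower_sqrt by assumption.
    assert (N3 : RtoC (INR n * INR (fact n)) <> 0) by (apply C_neq_0_of_Re; simpl; pose proof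
        (INR_fact_lt_0 n); nra).
    assert (N4 := Rcpow_neq_0 (INR n) s).
    assert (N5 : RtoC (sqrt (INR n)) <> 0) by (apply C_neq_0_of_Re; simpl; apply Rgt_not_eq,
        sqrt_lt_R0, HN).
    field. repeat split; auto. }
  assert (Hd : is_lim_seq (fun n => 2 * l1norm s * / INR (S n))%R 0%R).
  { replace (Finite 0) with (Rbar_mult (2 * l1norm s)%R 0%R) by (simpl; f_equal; ring).
    apply is_lim_seq_scal_l. apply (is_lim_seq_incr_1 (fun n => / INR n)%R). apply
        is_lim_seq_inv_INR. }
  destruct (is_lim_seq_0_lt _ (1 / 2) Hd ltac:(lra)) as [N HN].
  (* Boundedness of [b] is not yet known. From |b - F| <= |c - F| + d (|b - F| + |F|) and d < 1/2,
     the term d |b - F| is absorbed on the left, which produces the factors 2. *)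
  unfold Ccv. apply (is_lim_seq_0_le _ (fun n => 2 * Cmod (c n - beta_quot s)%C + (2 * Cmod
      (beta_quot s)) * (2 * l1norm s * / INR (S n)))%R).
  2:{ now apply is_lim_seq_lin_0. }
  exists N. intros n Hn. split; [apply Cmod_ge_0|]. specialize (HN n Hn).
  set (F := beta_quot s) in *. set (d := (2 * l1norm s * / INR (S n))%R) in *.
  assert (B : (Cmod (c n - b n)%C <= d * Cmod (b n))%R).
  { unfold c, b. replace (sqrt (INR n) * beta_int 0 (s + INR (S (S n))) - sqrt (INR n) * beta_int
      0 (INR (S (S n))))%C with
     (sqrt (INR n) * (beta_int 0 (s + INR (S (S n))) - beta_int 0 (INR (S (S n)))))%C by ring.
    rewrite !Cmod_mult. assert (Q := beta_int_diff_le s n ltac:(lra)).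
    apply (Rmult_le_compat_l (Cmod (sqrt (INR n)))) in Q; [|apply Cmod_ge_0].
    eapply Rle_trans; [exact Q|]. right. unfold d, Rdiv. ring. }
  assert (Hd0 : (0 <= d)%R).
  { unfold d. apply Rmult_le_pos; [pose proof (l1norm_pos s); lra|]. left. apply
      Rinv_0_lt_compat, lt_0_INR; lia. }
  assert (T1 := Cmod_triangle (c n - b n) (- (c n - F))).
  replace (c n - b n + - (c n - F))%C with (- (b n - F))%C in T1 by ring. rewrite !Cmod_opp in T1.
  assert (T2 := Cmod_triangle (b n - F) F). replace (b n - F + F)%C with (b n) in T2 by ring.
  pose proof (Cmod_ge_0 (b n - F)). pose proof (Cmod_ge_0 F). pose proof (Cmod_ge_0 (c n - F)).
  change (sqrt (INR n) * beta_int 0 (INR (S (S n))))%C with (b n).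
  assert (d * Cmod (b n) <= d * Cmod (b n - F)%C + d * Cmod F)%R by (rewrite <-
      Rmult_plus_distr_l; now apply Rmult_le_compat_l).
  assert (d * Cmod (b n - F)%C <= 1 / 2 * Cmod (b n - F)%C)%R by (apply Rmult_le_compat_r; lra).
  lra.
Qed.

Lemma beta_quot_const s s' : (0 < Re s)%R -> (0 < Re s')%R -> beta_quot s = beta_quot s'.
Proof. intros H H'. eapply Ccv_unique; apply beta_quot_lim; assumption. Qed.

(** * Value of the Beta integrals *)

(** Obtained from the monotonicity of sin, since the derivative of asin blows up at 1. *)
Lemma filterlim_asin_1 : filterlim asin (at_left 1) (locally (PI / 2)%R).
Proof.
  apply (filterlim_locally (U := R_UniformSpace)). intros eps.
  pose proof PI_RGT_0 as Hpi. pose proof (cond_pos eps) as He.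
  (* The cap at PI / 2 keeps PI / 2 - e in the interval where sin is increasing. *)
  set (e := Rmin eps (PI / 2)).
  assert (He' : (0 < e <= PI / 2)%R /\ (e <= eps)%R).
  { unfold e. split; [split; [apply Rmin_glb_lt; lra | apply Rmin_r] | apply Rmin_l]. }
  assert (Hs : (sin (PI / 2 - e) < 1)%R).
  { rewrite <- sin_PI2. apply sin_increasing_1; lra. }
  assert (K : at_left 1 (fun x => sin (PI / 2 - e) < x)%R).
  { apply filter_le_within. apply open_gt. exact Hs. }
  eapply filter_imp; [|exact (filter_and _ _ K (Dseg_at_left 1 Rlt_0_1))].
  intros x [H1 [H2 H3]].
  destruct (asin_bound_lt x ltac:(lra)) as [B1 B2].
  change (Rabs (asin x - PI / 2) < eps)%R. rewrite Rabs_left by lra.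
  assert (PI / 2 - e < asin x)%R.
  { apply sin_increasing_0; try lra. rewrite sin_asin by lra. exact H1. }
  lra.
Qed.

(** The integrand is 1 / sqrt (1 - x^2), with primitive asin. This is the source of the factor PI in
    the theorem. *)
Lemma beta_int_0_half : beta_int 0 (RtoC (1 / 2)) = RtoC (PI / 2).
Proof.
  assert (Hh : (0 < Re (RtoC (1 / 2)))%R) by (simpl; lra).
  assert (H : is_RInt_gen (V := CV) (beta_f 1 0 (RtoC (1 / 2))) (at_point 0) (at_left 1) (minus
      (RtoC (PI / 2)) (RtoC (asin 0)) : CV)).
  { apply (is_RInt_gen_derive (V := CV) (Dseg 1) (Dseg_conv 1) (Dseg_at_point 1 Rlt_0_1)
      (Dseg_at_left 1 Rlt_0_1) (fun x => RtoC (asin x))).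
    - intros x Hx. assert (Hw := sq_sub_pos 1 x Hx). unfold Dseg in Hx.
      replace (beta_f 1 0 (RtoC (1 / 2)) x) with (RtoC (/ sqrt (1 - x²))%R).
      + apply is_derive_RtoC. apply is_derive_Reals.
        assert (D := derive_pt_asin x ltac:(lra)).
        replace (/ sqrt (1 - x²))%R with (1 / sqrt (1 - x²))%R by (unfold Rdiv; ring).
        rewrite <- D. apply derive_pt_eq_1 with (pr := derivable_pt_asin x ltac:(lra)). f_equal.
      + unfold beta_f. simpl (2 * 0)%nat. rewrite pow_O, Cmult_1_l, <- RtoC_minus, Rcpow_RtoC.
          f_equal.
        replace (1 / 2 - 1)%R with (- / 2)%R by field. rewrite Rpower_Ropp, Rpower_sqrt by
            assumption.
        f_equal. f_equal. unfold Rsqr. ring.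
    - intros x. apply continuous_beta_f.
    - apply (filterlim_at_point (V := CV) (fun x => RtoC (asin x)) 0%R).
    - eapply filterlim_comp; [apply filterlim_asin_1|].
      exact (linear_cont (U := R_NormedModule) (V := CV) RtoC (PI / 2)%R is_linear_RtoC). }
  rewrite (is_RInt_gen_unique_C _ (at_point 0) (at_left 1) _ _ (beta_int_is 0 _ Hh) H).
  change (RtoC (PI / 2) + - RtoC (asin 0) = RtoC (PI / 2)). rewrite asin_0. ring.
Qed.

Lemma beta_int_0_1 : beta_int 0 1 = 1.
Proof.
  assert (H1 : (0 < Re 1)%R) by (simpl; lra).
  assert (H : is_RInt_gen (V := CV) (beta_f 1 0 1) (at_point 0) (at_left 1) (minus (RtoC 1) (RtoC
      0) : CV)).
  { apply (is_RInt_gen_derive (V := CV) (Dseg 1) (Dseg_conv 1) (Dseg_at_point 1 Rlt_0_1)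
      (Dseg_at_left 1 Rlt_0_1) (fun x => RtoC x)).
    - intros x Hx. replace (beta_f 1 0 1 x) with (RtoC 1).
      + apply is_derive_RtoC. apply (is_derive_id (K := R_AbsRing)).
      + unfold beta_f. simpl (2 * 0)%nat. rewrite pow_O, Cmult_1_l. replace (1 - 1)%C with (RtoC
          0) by ring. now rewrite Rcpow_0.
    - intros x. apply continuous_beta_f.
    - apply (filterlim_at_point (V := CV) RtoC 0%R).
    - intros P HP. apply filter_le_within. exact (linear_cont (U := R_NormedModule) (V := CV)
        RtoC 1%R is_linear_RtoC P HP). }
  rewrite (is_RInt_gen_unique_C _ (at_point 0) (at_left 1) _ _ (beta_int_is 0 _ H1) H).
  change (1 + - 0 = 1). ring.
Qed.

Lemma RtoC_half : RtoC (1 / 2) = / 2.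
Proof. rewrite RtoC_div by lra. unfold Cdiv. ring. Qed.

Lemma Re_half_pos : (0 < Re (RtoC (1 / 2)))%R.
Proof. simpl. lra. Qed.

Lemma beta_quot_1 : beta_quot 1 = Gamma_int (RtoC (1 / 2)) / 2.
Proof.
  unfold beta_quot. rewrite beta_int_0_1, Gamma_int_1. replace (1 + RtoC (1 / 2)) with (RtoC (1 /
      2) + 1) by ring.
  rewrite Gamma_int_succ by apply Re_half_pos. rewrite RtoC_half. field.
Qed.

(** The two values compared are F(1) = Gamma(1/2) / 2 and F(1/2) = (PI / 2) / Gamma(1/2). *)
Lemma Gamma_int_half_sqr : Gamma_int (RtoC (1 / 2)) * Gamma_int (RtoC (1 / 2)) = RtoC PI.
Proof.
  assert (H := beta_quot_const 1 (RtoC (1 / 2)) ltac:(simpl; lra) Re_half_pos).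
  rewrite beta_quot_1 in H. unfold beta_quot in H. rewrite beta_int_0_half in H.
  replace (RtoC (1 / 2) + RtoC (1 / 2)) with (RtoC 1) in H by (rewrite <- RtoC_plus; f_equal;
      field).
  rewrite Gamma_int_1 in H.
  assert (N := Gamma_int_neq_0 _ Re_half_pos). set (g := Gamma_int (RtoC (1 / 2))) in *.
  replace (g * g) with (2 * g * (g / 2)) by field. rewrite H.
  rewrite RtoC_div by lra. field. exact N.
Qed.

Lemma Re_INR_plus_pos k s : (0 < Re s)%R -> (0 < Re (RtoC (INR k) + s))%R.
Proof. intros H. simpl. pose proof (pos_INR k). unfold Re in H. lra. Qed.

(** Euler's formula for B(k + 1/2, s) / 2. The case k = 0 is the constancy of [beta_quot]; with a =
    k + 1/2, the recursion (a + s) I_(k+1)(s) = a I_k(s) matches the functional equations at a + s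
    and a. *)
Lemma beta_int_Gamma_int k s : (0 < Re s)%R ->
  beta_int k s * Gamma_int (RtoC (INR k) + RtoC (1 / 2) + s) = Gamma_int (RtoC (INR k) + RtoC (1
      / 2)) * Gamma_int s / 2.
Proof.
  intros Hs. induction k.
  - assert (H := beta_quot_const s 1 Hs ltac:(simpl; lra)). rewrite beta_quot_1 in H. unfold
      beta_quot in H.
    simpl INR. rewrite !Cplus_0_l. assert (N := Gamma_int_neq_0 s Hs).
    replace (RtoC (1 / 2) + s) with (s + RtoC (1 / 2)) by ring.
    replace (beta_int 0 s * Gamma_int (s + RtoC (1 / 2))) with (beta_int 0 s * Gamma_int (s +
        RtoC (1 / 2)) / Gamma_int s * Gamma_int s) by (field; auto).
    rewrite H. field.
  - set (a := RtoC (INR k) + RtoC (1 / 2)) in *.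
    assert (Ha : (0 < Re a)%R) by (apply Re_INR_plus_pos, Re_half_pos).
    replace (RtoC (INR (S k)) + RtoC (1 / 2)) with (a + 1) by (unfold a; rewrite RtoC_S; ring).
    replace (a + 1 + s) with (a + s + 1) by ring.
    assert (Has : (0 < Re (a + s))%R) by (change (0 < Re a + Re s)%R; lra).
    rewrite (Gamma_int_succ (a + s)), (Gamma_int_succ a) by assumption.
    assert (H1 := beta_int_shift k s Hs). assert (H2 := beta_int_parts k s Hs).
    assert (E : RtoC (INR (2 * k + 1)) = 2 * a).
    { unfold a. rewrite RtoC_half, plus_INR, mult_INR, RtoC_plus, RtoC_mult. simpl (INR 2). simpl
        (INR 1).
      replace (1 + 1)%R with 2%R by ring. field. }
    rewrite E, H1 in H2.
    assert (E2 : (a + s) * beta_int (S k) s = a * beta_int k s).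
    { replace ((a + s) * beta_int (S k) s) with (a * beta_int (S k) s + / 2 * (2 * s * beta_int
        (S k) s)) by field. rewrite <- H2. field. }
    replace (beta_int (S k) s * ((a + s) * Gamma_int (a + s))) with ((a + s) * beta_int (S k) s *
        Gamma_int (a + s)) by ring.
    rewrite E2. replace (a * beta_int k s * Gamma_int (a + s)) with (a * (beta_int k s *
        Gamma_int (a + s))) by ring.
    rewrite IHk. field.
Qed.

(** Legendre's duplication formula at integers. It is used twice: for the (2k)! of the cosine series
    and for the (2n)! of the cosh series. *)
Lemma Gamma_int_INR_half k :
  RtoC (INR (fact (2 * k))) * Gamma_int (RtoC (1 / 2)) = RtoC (4 ^ k * INR (fact k)) * Gamma_int
      (RtoC (INR k) + RtoC (1 / 2)).
Proof.
  induction k.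
  - simpl. rewrite Cplus_0_l. f_equal. f_equal. ring.
  - replace (2 * S k)%nat with (S (S (2 * k))) by lia.
    rewrite RtoC_S. replace (RtoC (INR k) + 1 + RtoC (1 / 2)) with (RtoC (INR k) + RtoC (1 / 2) +
        1) by ring.
    rewrite Gamma_int_succ by apply Re_INR_plus_pos, Re_half_pos.
    rewrite (fact_simpl (S (2 * k))), (fact_simpl (2 * k)), (fact_simpl k), !mult_INR.
    rewrite !RtoC_mult.
    rewrite (RtoC_S (S (2 * k))), (RtoC_S (2 * k)), (RtoC_S k), mult_INR, RtoC_mult. simpl (INR
        2). replace (1 + 1)%R with 2%R by ring.
    replace ((2 * INR k + 1 + 1) * ((2 * INR k + 1) * INR (fact (2 * k))) * Gamma_int (RtoC (1 /
        2)))
     with ((2 * INR k + 1 + 1) * (2 * INR k + 1) * (RtoC (INR (fact (2 * k))) * Gamma_int (RtoC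
         (1 / 2)))) by ring.
    rewrite IHk. rewrite RtoC_half. simpl (4 ^ S k)%R. rewrite !RtoC_mult. replace (RtoC 4) with
        (2 * 2) by (rewrite <- RtoC_mult; f_equal; ring). field.
Qed.

(** * The cosine integral as a Bessel function *)

Lemma sum_n_linear {U V : NormedModule R_AbsRing} (T : U -> V) (a : nat -> U) n :
  is_linear T -> sum_n (fun k => T (a k)) n = T (sum_n a n).
Proof.
  intros HT. induction n.
  - now rewrite !sum_O.
  - now rewrite !sum_Sn, IHn, (linear_plus T HT).
Qed.

Lemma is_series_linear {U V : NormedModule R_AbsRing} (T : U -> V) (a : nat -> U) l :
  is_linear T -> is_series a l -> is_series (fun k => T (a k)) (T l).
Proof.
  intros HT H. unfold is_series.
  eapply filterlim_ext; [|eapply filterlim_comp; [exact H | exact (linear_cont T l HT)]].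
  intros n. symmetry. now apply sum_n_linear.
Qed.

Lemma is_series_Cmult (c : C) (a : nat -> C) (l : C) :
  is_series (V := CV) a l -> is_series (V := CV) (fun k => c * a k) (c * l).
Proof. apply (is_series_linear (U := CV) (V := CV) (Cmult c)), is_linear_Cmult. Qed.

Lemma CSeries_unique (a : nat -> C) (l : C) : is_series (V := CV) a l -> CSeries a = l.
Proof.
  intros H. unfold CSeries.
  assert (H1 := is_series_linear (U := CV) (V := R_NormedModule) (fun z : CV => fst z) a l
      is_linear_fst H).
  assert (H2 := is_series_linear (U := CV) (V := R_NormedModule) (fun z : CV => snd z) a l
      is_linear_snd H).
  apply is_series_unique in H1. apply is_series_unique in H2. unfold Re, Im.
  destruct l as [l1 l2]. now f_equal.
Qed.

Lemma is_RInt_gen_rescale (f : R -> C) (u : R) (l : C) : (0 < u)%R ->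
  is_RInt_gen (V := CV) f (at_point 0) (at_left 1) l ->
  is_RInt_gen (V := CV) (fun x => f (/ u * x)%R) (at_point 0) (at_left u) (RtoC u * l).
Proof.
  intros Hu H P HP.
  assert (HP' : locally (l : CV) (fun z => P (RtoC u * z))) by exact (linear_cont (U := CV) (V :=
      CV) (Cmult u) l (is_linear_Cmult u) P HP).
  destruct (H _ HP') as [Q1 Q2 HQ1 [eps HQ2] HQ].
  (* The neighbourhood of [u] is the preimage of the one of 1 under division by [u], so its radius
     is multiplied by [u]. *)
  exists (fun a => a = 0%R) (fun b => Q2 (/ u * b)%R).
  - reflexivity.
  - exists (mkposreal _ (Rmult_lt_0_compat _ _ Hu (cond_pos eps))). intros y Hy Hyu. apply HQ2.
    + change (Rabs (y - u) < u * eps)%R in Hy. change (Rabs (/ u * y - 1) < eps)%R.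
      replace (/ u * y - 1)%R with (/ u * (y - u))%R by (field; lra).
      rewrite Rabs_mult, Rabs_pos_eq by (left; now apply Rinv_0_lt_compat).
      apply Rmult_lt_reg_l with u; [assumption|]. rewrite <- Rmult_assoc, Rinv_r, Rmult_1_l by
          lra. exact Hy.
    + apply Rmult_lt_reg_l with u; [assumption|]. rewrite <- Rmult_assoc, Rinv_r by lra. lra.
  - intros x y -> Hy.
    destruct (HQ 0%R (/ u * y)%R HQ1 Hy) as [z [Hz1 Hz2]]. simpl fst in *; simpl snd in *.
    exists (RtoC u * z). split; [|exact Hz2].
    assert (K : is_RInt (V := CV) f (/ u * 0 + 0) (/ u * y + 0) z) by (now rewrite Rmult_0_r,
        !Rplus_0_r).
    apply is_RInt_comp_lin in K.
    apply (is_RInt_linear (U := CV) (V := CV) (Cmult u) _ _ _ _ (is_linear_Cmult u)) in K.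
    eapply is_RInt_ext; [|exact K]. intros t _. cbv beta. rewrite Rplus_0_r.
    transitivity (RtoC u * (RtoC (/ u) * f (/ u * t)%R)).
    + f_equal. apply scal_R_Cmult.
    + rewrite RtoC_inv by lra. eq_in_C. field. apply C_neq_0_of_Re. simpl. lra.
Qed.

Lemma Rcpow_pow a z n : (0 < a)%R -> Rcpow (a ^ n) z = Rcpow a z ^ n.
Proof.
  intros Ha. induction n.
  - simpl. unfold Rcpow. rewrite ln_1, Cmult_0_r. apply Cexp_0.
  - simpl. rewrite Rcpow_mult, IHn; auto. now apply pow_lt.
Qed.

(** Homogeneity under x = u y: u^(2k) from the monomial, (u^2)^(s-1) from the weight, and u from
    dx. *)
Lemma is_RInt_gen_beta_f u k s : (0 < u)%R -> (0 < Re s)%R ->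
  is_RInt_gen (V := CV) (beta_f u k s) (at_point 0) (at_left u)
   (RtoC (u ^ (2 * k + 1)) * Rcpow u (s - 1) ^ 2 * beta_int k s).
Proof.
  intros Hu Hs.
  assert (H := is_RInt_gen_rescale _ u _ Hu (beta_int_is k s Hs)).
  assert (K := is_RInt_gen_Cmult (RtoC (u ^ (2 * k)) * Rcpow u (s - 1) ^ 2) _ (at_point 0)
      (at_left u) _ H).
  replace (RtoC (u ^ (2 * k + 1)) * Rcpow u (s - 1) ^ 2 * beta_int k s) with
    (RtoC (u ^ (2 * k)) * Rcpow u (s - 1) ^ 2 * (RtoC u * beta_int k s)) by (rewrite pow_add,
        pow_1, RtoC_mult; ring).
  eapply (is_RInt_gen_ext_D (Dseg u) (Dseg_conv u) (Dseg_at_point u Hu) (Dseg_at_left u Hu));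
      [|exact K].
  intros x Hx. cbv beta. unfold beta_f.
  assert (Hw := sq_sub_pos u x Hx).
  assert (Hx' : Dseg 1 (/ u * x)).
  { unfold Dseg in *. split.
    - apply Rmult_le_pos; [left; now apply Rinv_0_lt_compat | lra].
    - apply Rmult_lt_reg_l with u; [assumption|]. rewrite <- Rmult_assoc, Rinv_r by lra. lra. }
  assert (Hw1 := sq_sub_pos 1 _ Hx').
  replace (u ^ 2 - x ^ 2)%R with (u ^ 2 * (1 ^ 2 - (/ u * x) ^ 2))%R by (field; lra).
  rewrite Rcpow_mult, Rcpow_pow by (assumption || now apply pow_lt).
  replace (x ^ (2 * k))%R with (u ^ (2 * k) * (/ u * x) ^ (2 * k))%R.
  - rewrite RtoC_mult. eq_in_C. ring.
  - rewrite <- Rpow_mult_distr. f_equal. field. lra.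
Qed.

Lemma minus_sum_n_weight (a : nat -> C) (c W : C) n :
  minus (sum_n (G := CV) (fun k => a k * W) n) (c * W : CV) = (sum_n (G := CV) a n - c) * W.
Proof.
  assert (E : sum_n (G := CV) (fun k => a k * W) n = (W * sum_n (G := CV) a n)%C).
  { etransitivity; [|exact (sum_n_linear (U := CV) (V := CV) (Cmult W) a n (is_linear_Cmult W))].
    apply sum_n_ext. intros k. apply Cmult_comm. }
  rewrite E. change (W * sum_n (G := CV) a n - c * W = (sum_n (G := CV) a n - c) * W). ring.
Qed.

Lemma Ci_pow_even k : Ci ^ (2 * k) = RtoC ((-1) ^ k).
Proof.
  rewrite Cpow_mult_r. replace (Ci ^ 2) with (RtoC (-1)).
  - symmetry. apply RtoC_pow.
  - apply (injective_projections (A := R) (B := R)); simpl; ring.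
Qed.

Definition cos_f (u p : R) (s : C) (x : R) : C := RtoC (cos (p * x)) * Rcpow (u ^ 2 - x ^ 2) (s -
    1).

Lemma ex_RInt_gen_cos_f u p s : (0 < u)%R -> (0 < Re s)%R ->
  ex_RInt_gen (V := CV) (cos_f u p s) (at_point 0) (at_left u).
Proof.
  intros Hu Hs. apply (ex_RInt_gen_seg u (Re s) 1); auto.
  - intros x Hx. eapply continuous_of_derive. apply is_derive_Cmult; [|now apply
      is_derive_sq_sub_Rcpow].
    apply is_derive_RtoC. auto_derive; auto.
  - intros x Hx. unfold cos_f. rewrite Cmod_mult, Cmod_R, Cmod_Rcpow, Re_minus_1.
    apply Rmult_le_compat_r; [left; apply Rpower_pos|]. apply Rabs_le, COS_bound.
Qed.

(** Poisson's integral; the corresponding Bessel order is s - 1/2. *)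
Definition cos_int (u p : R) (s : C) : C := RInt_gen (V := CV) (cos_f u p s) (at_point 0)
    (at_left u).

Lemma cos_int_is u p s : (0 < u)%R -> (0 < Re s)%R ->
  is_RInt_gen (V := CV) (cos_f u p s) (at_point 0) (at_left u) (cos_int u p s).
Proof. intros Hu Hs. exact (is_RInt_gen_RInt_gen _ _ _ (ex_RInt_gen_cos_f u p s Hu Hs)). Qed.

(** The cosine is expanded as cosh (i p x), whose argument has modulus at most p u on the
    interval. *)
Lemma is_series_cos_int u p s : (0 < u)%R -> (0 < p)%R -> (0 < Re s)%R ->
  is_series (V := CV) (fun k => RtoC ((-1) ^ k * p ^ (2 * k) / INR (fact (2 * k))) *
    (RtoC (u ^ (2 * k + 1)) * Rcpow u (s - 1) ^ 2 * beta_int k s)) (cos_int u p s).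
Proof.
  intros Hu Hp Hs.
  apply (is_series_RInt_gen (V := CV) (Dseg u) (Dseg_conv u) (Dseg_at_point u Hu) (Dseg_at_left u
      Hu) (Dseg_le u Hu)
    (cos_f u p s) (fun k x => (Ci * RtoC (p * x)) ^ (2 * k) / INR (fact (2 * k)) * Rcpow (u ^ 2 -
        x ^ 2) (s - 1)) _ _
    (fun x => Rpower (u ^ 2 - x ^ 2) (Re s - 1)) (cosh_err (p * u))).
  - now apply cos_int_is.
  - intros k. eapply (is_RInt_gen_ext_D (Dseg u) (Dseg_conv u) (Dseg_at_point u Hu) (Dseg_at_left
      u Hu)).
    2:{ exact (is_RInt_gen_Cmult _ _ (at_point 0) (at_left u) _ (is_RInt_gen_beta_f u k s Hu
        Hs)). }
    intros x Hx. cbv beta. unfold beta_f.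
    rewrite Cpow_mult_l, Ci_pow_even, <- RtoC_pow, Rpow_mult_distr.
    rewrite RtoC_div by apply INR_fact_neq_0. rewrite !RtoC_mult. eq_in_C. unfold Cdiv. ring.
  - now apply ex_RInt_gen_sq_sub_Rpower.
  - apply is_lim_cosh_err.
  - intros n x Hx. unfold cos_f. rewrite <- Ccosh_Ci, minus_sum_n_weight, norm_C, Cmod_mult,
      Cmod_Rcpow, Re_minus_1.
    apply Rmult_le_compat_r; [left; apply Rpower_pos|].
    apply Ccosh_remainder. unfold Dseg in Hx.
    rewrite Cmod_mult, Cmod_Ci, Cmod_R, Rmult_1_l, Rabs_pos_eq by nra. nra.
Qed.

(** Poisson's representation of J_mu. The convergent series for [cos_int] is divided by the constant
    [c] and then agrees term by term with the Bessel series, which thereby converges as well. *)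
Lemma cos_int_eq_BesselJ u p (mu : C) : (0 < u)%R -> (0 < p)%R -> (- (1 / 2) < Re mu)%R ->
  cos_int u p (mu + RtoC (1 / 2)) =
  Gamma_int (RtoC (1 / 2)) / 2 * Gamma_int (mu + RtoC (1 / 2)) * Rcpow u mu / Rcpow (p / 2) mu *
      BesselJ mu (p * u).
Proof.
  intros Hu Hp Hmu. set (s := mu + RtoC (1 / 2)).
  assert (Hs : (0 < Re s)%R) by (unfold s; rewrite Re_plus_R; lra).
  set (g := Gamma_int (RtoC (1 / 2))).
  assert (Ng : g <> 0) by apply Gamma_int_neq_0, Re_half_pos.
  assert (Ns := Gamma_int_neq_0 s Hs).
  assert (Hp2 : (0 < p / 2)%R) by lra.
  set (c := g / 2 * Gamma_int s * Rcpow u mu / Rcpow (p / 2) mu).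
  assert (Nu := Rcpow_neq_0 u mu). assert (Np := Rcpow_neq_0 (p / 2) mu).
  assert (N2 : RtoC 2 <> 0) by (apply C_neq_0_of_Re; simpl; lra).
  assert (Nc : c <> 0).
  { unfold c, Cdiv.
    assert (Ni : forall z : C, z <> 0 -> / z <> 0).
    { intros z Hz E. apply C1_nz. rewrite <- (Cinv_r z Hz), E. ring. }
    do 4 (apply Cmult_neq_0; auto). }
  assert (H := is_series_Cmult (/ c) _ _ (is_series_cos_int u p s Hu Hp Hs)).
  unfold BesselJ. erewrite CSeries_unique.
  2:{ eapply is_series_ext; [|exact H]. intros k. cbv beta.
    rewrite Gamma_eq_Gamma_int.
    2:{ rewrite Re_plus_R. simpl. pose proof (pos_INR k). unfold Re in Hmu. lra. }
    assert (B := beta_int_Gamma_int k s Hs).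
    set (a := RtoC (INR k) + RtoC (1 / 2)) in *.
    assert (Ha : (0 < Re a)%R) by (apply Re_INR_plus_pos, Re_half_pos).
    assert (Nas : Gamma_int (a + s) <> 0) by (apply Gamma_int_neq_0; change (0 < Re a + Re s)%R;
        lra).
    replace (RtoC (INR k) + mu + RtoC 1) with (a + s).
    2:{ unfold a, s. rewrite RtoC_half. field. }
    assert (EB : beta_int k s = Gamma_int a * Gamma_int s / 2 / Gamma_int (a + s)) by (rewrite <-
        B; field; auto).
    assert (L := Gamma_int_INR_half k). fold a in L. fold g in L.
    assert (Nk := INR_fact_neq_0_C k). assert (N2k := INR_fact_neq_0_C (2 * k)).
    assert (N4 : RtoC (4 ^ k) <> 0) by (apply C_neq_0_of_Re; simpl; apply pow_nonzero; lra).
    (* Duplication cancels the (2k)! of the cosine series, supplies the k! of the Bessel series, and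
       its 4^k turns p^(2k) into (p/2)^(2k). *)
    assert (EG : Gamma_int a = RtoC (INR (fact (2 * k))) * g / (RtoC (4 ^ k) * RtoC (INR (fact
        k)))).
    { rewrite L, RtoC_mult. field. auto. }
    rewrite EB, EG. unfold c.
    rewrite !RtoC_div, !RtoC_mult by apply INR_fact_neq_0.
    replace (p * u / 2)%R with (p / 2 * u)%R by field.
    rewrite Rcpow_mult, !Rcpow_plus by assumption.
    replace (RtoC 2 * RtoC (INR k)) with (RtoC (INR (2 * k))) by (rewrite mult_INR, RtoC_mult;
        f_equal; f_equal; simpl; ring).
    rewrite !Rcpow_INR by assumption.
    replace (RtoC (p ^ (2 * k))) with (RtoC ((p / 2) ^ (2 * k)) * RtoC (4 ^ k)).
    2:{ rewrite <- RtoC_mult. f_equal. rewrite !pow_mult, <- Rpow_mult_distr. f_equal. field. }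
    (* Here 1 + 2 (s - 1) = 2 mu. One factor u^mu belongs to [c], the other to (p u / 2)^mu in the
       Bessel term. *)
    assert (Eu : RtoC (u ^ (2 * k + 1)) * Rcpow u (s - 1) ^ 2 = RtoC (u ^ (2 * k)) * Rcpow u mu ^
        2).
    { rewrite pow_add, pow_1, RtoC_mult. rewrite <- (Rcpow_1 u Hu).
      replace (RtoC (u ^ (2 * k)) * Rcpow u 1 * Rcpow u (s - 1) ^ 2) with (RtoC (u ^ (2 * k)) *
          (Rcpow u 1 * Rcpow u (s - 1) * Rcpow u (s - 1))) by ring.
      rewrite <- !Rcpow_plus. simpl Cpow. rewrite Cmult_1_r, <- Rcpow_plus. f_equal. f_equal.
          unfold s. rewrite RtoC_half. field. }
    rewrite Eu. eq_in_C. field. repeat split; auto. }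
  fold c. field. exact Nc.
Qed.

(** * Expansion in powers of q *)

(** Isolates the cosh factor; what is left is Poisson's integrand with s = 1/2 - nu. *)
Lemma lhs_integrand_eq u p q nu x :
  lhs_integrand u p q nu x = Ccosh (q * RtoC (sqrt (u ^ 2 - x ^ 2))) * cos_f u p (RtoC (1 / 2) -
      nu) x.
Proof.
  unfold lhs_integrand, cos_f, Cdiv. rewrite <- Rcpow_opp.
  replace (- (nu + RtoC (1 / 2))) with (RtoC (1 / 2) - nu - 1) by (rewrite RtoC_half; field).
  ring.
Qed.

Lemma Cmod_mult_sqrt_le u q x : Dseg u x -> (Cmod (q * RtoC (sqrt (u ^ 2 - x ^ 2)))%C <= Cmod q *
    u)%R.
Proof.
  intros Hx. rewrite Cmod_mult, Cmod_R, Rabs_pos_eq by apply sqrt_pos.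
  apply Rmult_le_compat_l; [apply Cmod_ge_0|]. unfold Dseg in Hx.
  rewrite <- (sqrt_square u) at 2 by lra. apply sqrt_le_1; nra.
Qed.

Lemma Cmod_Ccosh_le z : (Cmod (Ccosh z) <= exp (Cmod z))%R.
Proof.
  unfold Ccosh. rewrite Cmod_div by (apply C_neq_0_of_Re; simpl; lra). rewrite Cmod_R,
      (Rabs_pos_eq 2) by lra.
  assert (T := Cmod_triangle (Cexp z) (Cexp (- z))). rewrite !Cmod_Cexp in T.
  assert (H : forall w, Cmod w = Cmod z -> (exp (Re w) <= exp (Cmod z))%R).
  { intros w <-. assert (K : (Re w <= Cmod w)%R) by (eapply Rle_trans; [apply Rle_abs | apply
      re_le_Cmod]).
    destruct K as [K|K]; [left; now apply exp_increasing | rewrite K; lra]. }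
  assert (H1 := H z eq_refl). assert (H2 := H (- z) (Cmod_opp z)). lra.
Qed.

Lemma continuous_lhs_integrand u p q nu x : Dseg u x -> continuous (U := CV) (lhs_integrand u p q
    nu) x.
Proof.
  intros Hx. assert (Hw := sq_sub_pos u x Hx).
  assert (D1 : is_derive (V := CV) (fun x => RtoC (sqrt (u ^ 2 - x ^ 2))) x (RtoC (- 2 * x / (2 *
      sqrt (u ^ 2 - x ^ 2)))%R)).
  { apply is_derive_RtoC. apply (is_derive_sqrt (fun x => u ^ 2 - x ^ 2)%R); [apply
      is_derive_sq_sub | exact Hw]. }
  assert (D2 := is_derive_Cexp _ _ _ (is_derive_Cmult_l q _ _ _ D1)).
  assert (D3 := is_derive_Cexp _ _ _ (is_derive_Cmult_l (- (1)) _ _ _ (is_derive_Cmult_l q _ _ _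
      D1))).
  assert (D4 := is_derive_Cmult_l (/ 2) _ _ _ (is_derive_Cplus _ _ _ _ _ D2 D3)).
  assert (D5 : is_derive (V := CV) (fun x => RtoC (cos (p * x))) x (RtoC (- (p * sin (p * x))))).
  { apply is_derive_RtoC. auto_derive; auto. ring. }
  assert (D6 := is_derive_Cmult _ _ _ _ _ D5 (is_derive_sq_sub_Rcpow u (RtoC (1 / 2) - nu - 1) x
      Hx)).
  apply (continuous_ext (U := CV) (fun x => Ccosh (q * RtoC (sqrt (u ^ 2 - x ^ 2))) * cos_f u p
      (RtoC (1 / 2) - nu) x)).
  { intros t. symmetry. apply lhs_integrand_eq. }
  eapply continuous_of_derive. eapply is_derive_ext; [|exact (is_derive_Cmult _ _ _ _ _ D4 D6)].
  intros t. cbv beta. unfold Ccosh, cos_f, Cdiv.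
  replace (- (q * RtoC (sqrt (u ^ 2 - t ^ 2)))) with (- (1) * (q * RtoC (sqrt (u ^ 2 - t ^ 2))))
      by ring. eq_in_C. ring.
Qed.

Lemma ex_RInt_gen_lhs u p q nu : (0 < u)%R -> (Re nu < 1 / 2)%R ->
  ex_RInt_gen (V := CV) (lhs_integrand u p q nu) (at_point 0) (at_left u).
Proof.
  intros Hu Hnu. apply (ex_RInt_gen_seg u (Re (RtoC (1 / 2) - nu)) (exp (Cmod q * u))); auto.
  - simpl. unfold Re in Hnu. lra.
  - intros x. apply continuous_lhs_integrand.
  - intros x Hx. rewrite lhs_integrand_eq. unfold cos_f.
    rewrite !Cmod_mult, Cmod_Rcpow, Re_minus_1, Cmod_R.
    apply Rmult_le_compat; [apply Cmod_ge_0 | apply Rmult_le_pos; [apply Rabs_pos | left; apply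
        Rpower_pos] | |].
    + eapply Rle_trans; [apply Cmod_Ccosh_le|].
      destruct (Cmod_mult_sqrt_le u q x Hx) as [K|K]; [left; now apply exp_increasing | rewrite
          K; lra].
    + rewrite <- (Rmult_1_l (Rpower _ _)) at 2. apply Rmult_le_compat_r; [left; apply
        Rpower_pos|]. apply Rabs_le, COS_bound.
Qed.

(** The even power 2n of the square root is (u^2 - x^2)^n, which raises s from 1/2 - nu to n + 1/2 -
    nu. The weight of the case n = 0, integrable because Re nu < 1/2, dominates the error of every
    partial sum. *)
Lemma is_series_lhs u p q nu : (0 < u)%R -> (Re nu < 1 / 2)%R ->
  is_series (V := CV) (fun n => q ^ (2 * n) / RtoC (INR (fact (2 * n))) * cos_int u p (RtoC (INR
      n) - nu + RtoC (1 / 2)))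
   (RInt_gen (V := CV) (lhs_integrand u p q nu) (at_point 0) (at_left u)).
Proof.
  intros Hu Hnu.
  apply (is_series_RInt_gen (V := CV) (Dseg u) (Dseg_conv u) (Dseg_at_point u Hu) (Dseg_at_left u
      Hu) (Dseg_le u Hu)
    (lhs_integrand u p q nu)
    (fun n x => (q * RtoC (sqrt (u ^ 2 - x ^ 2))) ^ (2 * n) / INR (fact (2 * n)) * cos_f u p
        (RtoC (1 / 2) - nu) x) _ _
    (fun x => Rpower (u ^ 2 - x ^ 2) (Re (RtoC (1 / 2) - nu) - 1)) (cosh_err (Cmod q * u))).
  - exact (is_RInt_gen_RInt_gen _ (at_point 0) (at_left u) (ex_RInt_gen_lhs u p q nu Hu Hnu)).
  - intros n. eapply (is_RInt_gen_ext_D (Dseg u) (Dseg_conv u) (Dseg_at_point u Hu) (Dseg_at_left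
      u Hu)).
    2:{ apply (is_RInt_gen_Cmult _ _ (at_point 0) (at_left u) _ (cos_int_is u p _ Hu
          (ltac:(rewrite Re_plus_R; simpl; pose proof (pos_INR n); unfold Re in Hnu; lra)
            : (0 < Re (RtoC (INR n) - nu + RtoC (1 / 2)))%R))). }
    intros x Hx. assert (Hw := sq_sub_pos u x Hx). cbv beta. unfold cos_f.
    replace (RtoC (INR n) - nu + RtoC (1 / 2) - 1) with (RtoC (INR n) + (RtoC (1 / 2) - nu - 1))
        by ring.
    rewrite Rcpow_plus, Rcpow_INR by exact Hw.
    rewrite Cpow_mult_l, <- RtoC_pow, pow_mult, pow2_sqrt by lra. eq_in_C. unfold Cdiv. ring.
  - apply ex_RInt_gen_sq_sub_Rpower; [exact Hu|]. simpl. unfold Re in Hnu. lra.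
  - apply is_lim_cosh_err.
  - intros n x Hx. rewrite lhs_integrand_eq. rewrite minus_sum_n_weight, norm_C, Cmod_mult.
    apply Rmult_le_compat; [apply Cmod_ge_0 | apply Cmod_ge_0 | apply Ccosh_remainder; now apply
        Cmod_mult_sqrt_le |].
    unfold cos_f. rewrite Cmod_mult, Cmod_R, Cmod_Rcpow, Re_minus_1. rewrite <- (Rmult_1_l
        (Rpower _ _)) at 2.
    apply Rmult_le_compat_r; [left; apply Rpower_pos|]. apply Rabs_le, COS_bound.
Qed.

(** Bookkeeping of constants with mu = n - nu: PI is Gamma(1/2)^2, (2n)! is rewritten by
    duplication, and p^mu = (p/2)^mu 2^mu. *)
Lemma cos_int_term_eq_rhs_term u p q nu n : (0 < u)%R -> (0 < p)%R -> (Re nu < 1 / 2)%R ->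
  q ^ (2 * n) / RtoC (INR (fact (2 * n))) * cos_int u p (RtoC (INR n) - nu + RtoC (1 / 2)) =
  RtoC PI * rhs_term u p q nu n.
Proof.
  intros Hu Hp Hnu.
  assert (Hmu : (- (1 / 2) < Re (RtoC (INR n) - nu))%R) by (simpl; pose proof (pos_INR n); unfold
      Re in Hnu; lra).
  rewrite cos_int_eq_BesselJ by assumption. unfold rhs_term.
  set (J := BesselJ (RtoC (INR n) - nu) (p * u)).
  replace (RtoC (INR n) + RtoC (1 / 2) - nu) with (RtoC (INR n) - nu + RtoC (1 / 2)) by ring.
  rewrite !Gamma_eq_Gamma_int; [| apply Re_INR_plus_pos, Re_half_pos | rewrite Re_plus_R; lra].
  set (mu := RtoC (INR n) - nu) in *.
  assert (L := Gamma_int_INR_half n).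
  assert (Na := Gamma_int_neq_0 _ (Re_INR_plus_pos n _ Re_half_pos)).
  set (ga := Gamma_int (RtoC (INR n) + RtoC (1 / 2))) in *.
  rewrite <- Gamma_int_half_sqr.
  assert (Ng := Gamma_int_neq_0 _ Re_half_pos). set (g := Gamma_int (RtoC (1 / 2))) in *.
  (* In this form 2^(n+nu+1) splits into 2 times 4^n, where 4^n cancels against duplication, and
     2^(-mu), which cancels against p^mu. *)
  replace (RtoC (INR n) + nu + RtoC 1) with (RtoC (INR (2 * n + 1)) - mu).
  2:{ unfold mu. rewrite plus_INR, mult_INR, RtoC_plus, RtoC_mult. simpl (INR 2). simpl (INR 1).
      replace (1 + 1)%R with 2%R by ring. ring. }
  rewrite Rcpow_minus, Rcpow_INR by lra.
  assert (Ep : Rcpow p mu = Rcpow (p / 2) mu * Rcpow 2 mu).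
  { rewrite <- Rcpow_mult by lra. f_equal. field. }
  rewrite Ep.
  assert (N1 := Rcpow_neq_0 (p / 2) mu). assert (N2 := Rcpow_neq_0 2 mu).
  assert (N3 := INR_fact_neq_0_C n). assert (N4 := INR_fact_neq_0_C (2 * n)).
  assert (N5 : RtoC (4 ^ n) <> 0) by (apply C_neq_0_of_Re; simpl; apply pow_nonzero; lra).
  rewrite RtoC_mult in L.
  assert (EF : RtoC (INR (fact (2 * n))) = RtoC (4 ^ n) * RtoC (INR (fact n)) * ga / g) by
      (rewrite <- L; field; auto).
  rewrite EF.
  replace (RtoC (2 ^ (2 * n + 1))) with (2 * RtoC (4 ^ n)).
  2:{ rewrite <- RtoC_mult. f_equal. rewrite pow_add, pow_mult. replace (2 ^ 2)%R with 4%R by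
      ring. ring. }
  field. repeat split; auto.
Qed.

Theorem mainTheorem16 (u p : R) (q nu : C)
  (hu : (0 < u)%R) (hp : (0 < p)%R) (hnu : (Re nu < 1 / 2)%R) :
  ex_RInt_gen (V := C_R_NormedModule) (lhs_integrand u p q nu)
    (at_point 0) (at_left u)
  /\ ex_series (V := C_R_NormedModule) (rhs_term u p q nu)
  /\ RInt_gen (V := C_R_CompleteNormedModule) (lhs_integrand u p q nu)
       (at_point 0) (at_left u)
     = RtoC PI * CSeries (rhs_term u p q nu).
Proof.
  assert (Npi : RtoC PI <> 0) by (apply C_neq_0_of_Re, PI_neq0).
  assert (H := is_series_lhs u p q nu hu hnu).
  (* The integral is hidden behind an opaque [L], so that the algebra below treats it as an atom. *)
  destruct (ex_intro (fun L : C => RInt_gen (V := CV) (lhs_integrand u p q nu) (at_point 0) (at_left u) = L) _ eq_refl) as [L EL].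
  rewrite EL in H |- *.
  (* Dividing the expansion of the integral by PI gives both the convergence of the right-hand
     series and its sum. *)
  assert (S : is_series (V := CV) (rhs_term u p q nu) (/ RtoC PI * L)).
  { eapply is_series_ext; [|exact (is_series_Cmult (/ RtoC PI) _ _ H)].
    intros n. cbv beta. rewrite cos_int_term_eq_rhs_term by assumption. eq_in_C. field. exact Npi. }
  repeat split.
  - exact (ex_RInt_gen_lhs u p q nu hu hnu).
  - now exists (/ RtoC PI * L).
  - rewrite (CSeries_unique _ _ S). eq_in_C. field. exact Npi.
Qed.
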